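(* Let $G$ be a graph of order $n$. Then $\phi'(G)\le 10^{n/5}$. Furthermore, $\phi'(G)=10^{n/5}$ if and only if $n\equiv 0\pmod 5$ and $G$ is the disjoint union of $n/5$ graphs, each of which is isomorphic to a graph obtained from $K_5$ by deleting $i$ pairwise non-adjacent edges (a matching of size $i$) for some $0\le i\le 2$.
   Context: All graphs are finite, simple, undirected and labeled. A subset $F$ of vertices of a graph $G$ is a dissociation set if the induced subgraph $G[F]$ has maximum degree at most $1$. A maximum dissociation set is a dissociation set of maximum cardinality. $\phi'(G)$ denotes the number of maximum dissociation sets of $G$. *)

(* Defs.v *)
(* A simple graph on vertex set T is a symmetric,
   irreflexive relation e : rel T on a finType T. *)
From mathcomp Require Import all_boot.
Set Implicit Arguments. Unset Strict Implicit. Unset Printing Implicit Defensive.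

Definition dissociation {T : finType} (e : rel T) (F : {set T}) : bool :=
  [forall x in F, #|[set y in F | e x y]| <= 1].

Definition diss_number {T : finType} (e : rel T) : nat :=
  \max_(F : {set T} | dissociation e F) #|F|.

Definition num_max_diss {T : finType} (e : rel T) : nat :=
  #|[set F : {set T} | dissociation e F & #|F| == diss_number e]|.

Definition matching_K5 (M : {set {set 'I_5}}) : bool :=
  [forall S in M, #|S| == 2] && trivIset M.

Definition induced_iso_K5_minus {T : finType} (e : rel T) (B : {set T})
    (M : {set {set 'I_5}}) : Prop :=
  exists f : 'I_5 -> T,
    [/\ injective f, f @: [set: 'I_5] = B &
        forall u v : 'I_5, e (f u) (f v) = (u != v) && ([set u; v] \notin M)].

(* Main.v *)
(* Let x = 10^(-1/5) and let f(S) be the number of maximum dissociation sets of the subgraph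
   induced by S. If A is a union of components of F[D], with no edge from A leaving D, then the
   maximum sets F with F meeting D in A are at most f(S - D) in number, because F - A is a
   maximum set of S - D. By induction this is at most x^|D| 10^(|S|/5). Splitting according to
   whether a vertex v of degree d is absent from F, isolated in F or mated in F to a neighbour u
   gives
     f(S) / 10^(|S|/5) <= x + x^(d+1) + sum over u of x^|N[u] u N[v]|,
   where the middle term vanishes as soon as some neighbour u is dominated, i.e. N[u] is
   contained in N[v]: a maximum set in which v is isolated could then be enlarged by u. This
   is < 1 when d >= 5, and also when d = 4 unless N[v] is a component. Degrees at most 3 are
   settled by refinements of this count. So equality forces a component on 5 vertices with 10
   maximum sets, and these are K5 minus a matching. *)
Require Import Defs.
From mathcomp Require Import all_boot all_order all_algebra realalg.
From mathcomp Require Import ring lra.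
Import GRing.Theory Num.Theory Order.TTheory.
Set Implicit Arguments. Unset Strict Implicit. Unset Printing Implicit Defensive.

Section MaximumDissociationSets.
Variables (T : finType) (e : rel T).
Hypotheses (e_sym : symmetric e) (e_irr : irreflexive e).
Implicit Types (S F D A B C : {set T}) (u v w : T).

(** * Dissociation sets, and the maximum ones inside a vertex subset *)

Lemma dissociationP F :
  reflect (forall x y z, x \in F -> y \in F -> z \in F -> e x y -> e x z -> y = z)
          (dissociation e F).
Proof.
apply: (iffP forall_inP) => [dF x y z xF yF zF xy xz | dF x xF].
  by have /card_le1_eqP := dF x xF; apply; rewrite !inE ?yF ?zF ?xy ?xz.
apply/card_le1_eqP => y z; rewrite !inE => /andP[yF xy] /andP[zF xz].
exact: (dF x z y).
Qed.

Lemma dissociationS F A : A \subset F -> dissociation e F -> dissociation e A.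
Proof.
move=> /subsetP sAF /dissociationP dF; apply/dissociationP => x y z xA yA zA.
by apply: dF; apply: sAF.
Qed.

Lemma dissociationU F A :
    (forall x y, x \in A -> y \in F -> ~~ e x y) ->
  dissociation e A -> dissociation e F -> dissociation e (A :|: F).
Proof.
move=> nAF /dissociationP dA /dissociationP dF; apply/dissociationP => x y z.
have nFA p q : p \in F -> q \in A -> ~~ e p q.
  by move=> pF qA; rewrite e_sym; apply: nAF.
move=> /setUP[]xX /setUP[]yX /setUP[]zX xy xz;
  try (by move: (nAF _ _ xX yX); rewrite xy);
  try (by move: (nAF _ _ xX zX); rewrite xz);
  try (by move: (nFA _ _ xX yX); rewrite xy);
  try (by move: (nFA _ _ xX zX); rewrite xz).
- exact: dA xy xz.
- exact: dF xy xz.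
Qed.

(** The maximum sets of the subgraph induced by [S]. Staying inside the fixed type [T] turns vertex
    deletion into set difference, and maximality by comparison avoids naming the dissociation number
    of each subset. *)
Definition maxdiss S : {set {set T}} :=
  [set F : {set T} | [&& F \subset S, dissociation e F &
    [forall F' : {set T}, (F' \subset S) && dissociation e F' ==> (#|F'| <= #|F|)]]].

Lemma maxdissP S F :
  reflect [/\ F \subset S, dissociation e F &
    forall F', F' \subset S -> dissociation e F' -> #|F'| <= #|F|]
    (F \in maxdiss S).
Proof.
rewrite inE; apply: (iffP and3P) => [[FS dF /forallP mF]|[FS dF mF]]; split=> //.
  by move=> F' FS' dF'; move/implyP: (mF F'); apply; rewrite FS'.
by apply/forallP => F'; apply/implyP => /andP[]; apply: mF.
Qed.

Lemma num_max_dissE : num_max_diss e = #|maxdiss setT|.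
Proof.
apply: eq_card => F; rewrite !inE subsetT /=; case dF: (dissociation e F) => //=.
apply/eqP/forallP => [-> F'|mF].
  by apply/implyP => /andP[_ dF']; apply: leq_bigmax_cond.
apply/eqP; rewrite eqn_leq; apply/andP; split; first exact: leq_bigmax_cond.
by apply/bigmax_leqP => F' dF'; have /implyP := mF F'; apply; rewrite subsetT.
Qed.

Lemma maxdiss_sub S F : F \in maxdiss S -> F \subset S.
Proof. by case/maxdissP. Qed.

Lemma maxdiss_mate_unique S F x y z :
  F \in maxdiss S -> x \in F -> y \in F -> z \in F -> e x y -> e x z -> y = z.
Proof. by case/maxdissP => _ /dissociationP dF _; apply: dF. Qed.

(** By maximality [v |: F] violates the degree condition: either a neighbour [u] of [v] already has
    a mate [w], or [v] itself would get two neighbours in [F]. *)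
Lemma maxdiss_ext S F v : F \in maxdiss S -> v \in S -> v \notin F ->
  exists u w, [/\ u \in F, w \in F, e v u & e u w \/ (e v w /\ w != u)].
Proof.
move=> FS vS vF.
have [FsS dF mF] := maxdissP _ _ FS; have /dissociationP dF' := dF.
case: (boolP [exists u, exists w, [&& u \in F, w \in F, e v u & e u w || (e v w && (w != u))]]).
  case/existsP => u /existsP[w /and4P[uF wF vu H]]; exists u, w; split=> //.
  by case/orP: H => [|/andP[? ?]]; [left | right].
move/existsPn => nE.
have {nE} nE u w : u \in F -> w \in F -> e v u -> (e u w = false) /\ (e v w -> w = u).
  move=> uF wF vu; have /existsPn/(_ w) := nE u.
  rewrite uF wF vu /= negb_or negb_and negbK => /andP[/negbTE -> H]; split=> //.
  by move=> vw; move: H; rewrite vw => /eqP.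
have /(mF (v |: F)) : v |: F \subset S by rewrite subUset sub1set vS.
rewrite cardsU1 vF ltnn => H; suff /H : dissociation e (v |: F) by [].
apply/dissociationP => x y z /setU1P[->|xF] /setU1P[->|yF] /setU1P[->|zF];
  rewrite ?e_irr // => xy xz.
- by have [_ ->] := nE _ _ zF yF xz.
- by move: xz; rewrite e_sym in xy; have [-> _] := nE _ _ xF zF xy.
- by move: xy; rewrite e_sym in xz; have [-> _] := nE _ _ xF yF xz.
- exact: dF' xy xz.
Qed.

(** * Neighbourhoods inside a subset, and counts of maximum sets with a given property *)

Definition nb S v := [set y in S | e v y].
Definition cnb S v := v |: nb S v.

Lemma in_nb S v y : (y \in nb S v) = (y \in S) && e v y.
Proof. by rewrite inE. Qed.

Lemma in_cnb S v y : (y \in cnb S v) = (y == v) || (y \in S) && e v y.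
Proof. by rewrite !inE. Qed.

Lemma cnb_sub S v : v \in S -> cnb S v \subset S.
Proof. by move=> vS; apply/subsetP => y; rewrite in_cnb => /predU1P[-> //|/andP[]]. Qed.

Lemma card_cnb S v : #|cnb S v| = #|nb S v|.+1.
Proof. by rewrite cardsU1 in_nb e_irr andbF. Qed.

Definition sel S (P : pred {set T}) := [set F : {set T} | (F \in maxdiss S) && P F].
Definition cnt S (P : pred {set T}) := #|sel S P|.

Lemma in_sel S P F : (F \in sel S P) = (F \in maxdiss S) && P F.
Proof. by rewrite in_set. Qed.

(* Removing [A] from [F] leaves a maximum dissociation set of [S :\: D]. *)
Lemma cnt_trace S D A :
    (forall x y, x \in A -> y \in S -> e x y -> y \in D) ->
  cnt S (fun F => F :&: D == A) <= #|maxdiss (S :\: D)|.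
Proof.
move=> clA; rewrite /cnt.
set Q := sel _ _.
have AF F : F \in Q -> [/\ F \in maxdiss S, F :&: D = A, A \subset F & A \subset D].
  rewrite in_sel => /andP[? /eqP FD]; split=> //; rewrite -FD; [exact: subsetIl|exact: subsetIr].
have injQ : {in Q &, injective (fun F => F :\: A)}.
  move=> F F' /AF[_ _ sF _] /AF[_ _ sF' _] /= E.
  by rewrite -(setID F A) -(setID F' A) E (setIidPr sF) (setIidPr sF').
rewrite -(card_in_imset injQ); apply/subset_leq_card/subsetP => _ /imsetP[F /AF[FS FD AsF AsD] ->].
have [FsS dF mF] := maxdissP _ _ FS.
apply/maxdissP; split.
- apply/subsetP => y; rewrite !inE => /andP[yA yF]; rewrite (subsetP FsS) // andbT.
  by apply: contra yA => yD; rewrite -FD inE yF.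
- by apply: dissociationS dF; apply: subsetDl.
move=> F' sF' dF'.
have AF0 : A :&: F' = set0.
  apply/setP => y; rewrite !inE; apply/negP => /andP[yA yF'].
  by move/subsetP: sF' => /(_ _ yF'); rewrite inE (subsetP AsD).
have := mF (A :|: F'); rewrite cardsU AF0 cards0 subn0 cardsD (setIidPr AsF) => H.
rewrite leq_subRL ?subset_leq_card //; apply: H.
  rewrite subUset (subset_trans AsF) //=.
  by apply: subset_trans sF' _; apply: subsetDl.
apply: dissociationU => //; last exact: dissociationS dF.
move=> p q pA qF'; apply/negP => pq.
move/subsetP: sF' => /(_ _ qF'); rewrite inE => /andP[/negP nD qS].
by apply/nD/(clA p).
Qed.

Lemma cnt_all S : #|maxdiss S| = cnt S predT.
Proof. by apply: eq_card => F; rewrite in_sel andbT. Qed.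

Lemma cntU S (P P1 P2 : pred {set T}) :
    (forall F, F \in maxdiss S -> P F -> P1 F || P2 F) ->
  cnt S P <= cnt S P1 + cnt S P2.
Proof.
move=> H; apply: leq_trans (leq_card_setU _ _).
apply/subset_leq_card/subsetP => F; rewrite in_setU !in_sel => /andP[FS /(H _ FS)].
by rewrite FS.
Qed.

Lemma cnt_le S (P P1 : pred {set T}) :
  (forall F, F \in maxdiss S -> P F -> P1 F) -> cnt S P <= cnt S P1.
Proof.
move=> H; apply/subset_leq_card/subsetP => F; rewrite !in_sel => /andP[FS PF].
by rewrite FS (H _ FS PF).
Qed.

Lemma cnt_exists S (A : {set T}) (Q : T -> pred {set T}) :
  cnt S (fun F => [exists u in A, Q u F]) <= \sum_(u in A) cnt S (Q u).
Proof.
rewrite /cnt.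
have -> : sel S (fun F => [exists u in A, Q u F]) = \bigcup_(u in A) sel S (Q u).
  apply/setP => F; rewrite in_sel; apply/andP/bigcupP.
    by case=> FS /exists_inP[u uA QF]; exists u; rewrite // inE FS.
  by case=> u uA; rewrite in_sel => /andP[FS QF]; split=> //; apply/exists_inP; exists u.
elim/big_rec2: _ => [|u n D _ IH]; first by rewrite cards0.
by apply: leq_trans (leq_card_setU _ _) _; rewrite leq_add2l.
Qed.

(** * Branching on the status of a vertex *)

(** All three predicates prescribe the intersection of [F] with some set, the shape that [cnt_trace]
    bounds. Their usual meaning is recovered in [avoidsE], [isolatedP] and [matedP]. *)
Definition avoids v : pred {set T} := fun F => F :&: [set v] == set0.
Definition isolated S v : pred {set T} := fun F => F :&: cnb S v == [set v].
Definition mated S u v : pred {set T} :=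
  fun F => F :&: (cnb S u :|: cnb S v) == [set u; v].

Lemma avoidsE v F : avoids v F = (v \notin F).
Proof.
rewrite /avoids; apply/eqP/idP => [/setP/(_ v)|vF]; first by rewrite !inE eqxx andbT => ->.
by apply/setP => y; rewrite !inE; case: eqP => [->|]; rewrite ?andbF // (negbTE vF).
Qed.

Lemma cnt_avoids S v : cnt S (avoids v) <= #|maxdiss (S :\ v)|.
Proof. by apply: cnt_trace => x y; rewrite in_set0. Qed.

Lemma cnt_isolated S v : cnt S (isolated S v) <= #|maxdiss (S :\: cnb S v)|.
Proof. by apply: cnt_trace => x y /set1P -> yS vy; rewrite in_cnb yS vy orbT. Qed.

Lemma cnt_mated S u v :
  cnt S (mated S u v) <= #|maxdiss (S :\: (cnb S u :|: cnb S v))|.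
Proof.
by apply: cnt_trace => x y /set2P[]-> yS vy; rewrite inE !in_cnb yS vy !orbT.
Qed.

Lemma isolatedP S F v : F \in maxdiss S ->
  reflect (v \in F /\ forall u, u \in F -> ~~ e v u) (isolated S v F).
Proof.
move=> FS; have /subsetP sFS := maxdiss_sub FS.
apply: (iffP eqP) => [/setP E|[vF nF]].
  have := E v; rewrite in_setI in_cnb in_set1 eqxx andbT => vF; split=> // u uF.
  apply/negP => vu; have := E u; rewrite in_setI in_cnb in_set1 uF vu sFS //= orbT.
  by move/esym/eqP => uv; rewrite uv e_irr in vu.
apply/setP => y; rewrite in_setI in_cnb in_set1; case: eqP => [->|_] /=; first by rewrite vF.
by apply/negP => /and3P[yF _]; apply/negP/nF.
Qed.

Lemma matedP S F u v : F \in maxdiss S -> e u v ->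
  reflect (u \in F /\ v \in F) (mated S u v F).
Proof.
move=> FS uv; have /subsetP sFS := maxdiss_sub FS.
apply: (iffP eqP) => [/setP E|[uF vF]].
  have := E v; have := E u; rewrite !in_setI in_set2 eqxx => /andP[uF _].
  by rewrite in_set2 eqxx orbT => /andP[vF _].
apply/setP => y; rewrite in_setI in_setU !in_cnb in_set2.
apply/andP/orP => [[yF /orP[/predU1P[->|/andP[_ uy]]|/predU1P[->|/andP[_ vy]]]]|[]/eqP->];
  rewrite ?eqxx ?orbT; auto.
- by right; apply/eqP; apply: (maxdiss_mate_unique FS uF).
- by left; apply/eqP; apply: (maxdiss_mate_unique FS vF); rewrite // e_sym.
Qed.

Lemma in_maxdissP S F v : F \in maxdiss S -> v \in F ->
  isolated S v F || [exists u in nb S v, mated S v u F].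
Proof.
move=> FS vF; have /subsetP sFS := maxdiss_sub FS.
case: (boolP [exists u in nb S v, _]); rewrite ?orbT // => /exists_inPn nE; rewrite orbF.
apply/isolatedP => //; split=> // u uF; apply/negP => vu.
have /nE/negP : u \in nb S v by rewrite in_nb sFS.
by apply; apply/matedP.
Qed.

(** Maximality must prevent adding [u]; as [v] has no mate in [F], the obstruction involves a second
    neighbour of [u]. *)
Lemma isolated_other_nb S F u v : F \in maxdiss S -> isolated S v F -> u \in nb S v ->
  exists2 w, w \in F & e u w && (w != v).
Proof.
move=> FS iv; rewrite in_nb => /andP[uS vu]; have [vF nF] := isolatedP _ FS iv.
have uF : u \notin F by apply/negP => /nF; rewrite vu.
have [p [q [pF qF up H]]] := maxdiss_ext FS uS uF.
case: (eqVneq p v) => [E|pv]; last by exists p; rewrite // up.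
case: H => [pq|[uq qp]]; last by exists q; rewrite // uq -E.
by have := nF _ qF; rewrite -E pq.
Qed.

Lemma branch S v : v \in S ->
  #|maxdiss S| <= cnt S (avoids v) + cnt S (isolated S v)
                  + cnt S (fun F => [exists u in nb S v, mated S v u F]).
Proof.
move=> vS; rewrite cnt_all -addnA.
apply: leq_trans (_ : cnt S (avoids v) + cnt S (fun F => v \in F) <= _).
  by apply: cntU => F _ _; rewrite avoidsE orNb.
rewrite leq_add2l; apply: cntU => F FS vF; exact: in_maxdissP.
Qed.

(** Mating [v] with such a neighbour removes only N[v], so the bound for the pair may lack one
    factor [x]; in return, a single such neighbour excludes that [v] is isolated. *)
Definition dominated S v := [set u in nb S v | cnb S u \subset cnb S v].

(** The second neighbour of the dominated vertex given by [isolated_other_nb] would lie in N[v], so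
    [v] would not be isolated. *)
Lemma isolated_dominated0 S v : dominated S v != set0 -> cnt S (isolated S v) = 0.
Proof.
case/set0Pn => u; rewrite inE => /andP[uN /subsetP sub]; apply: eq_card0 => F.
rewrite in_sel; apply/negP => /andP[FS iF].
have [w wF /andP[uw wv]] := isolated_other_nb FS iF uN.
have [_ nF] := isolatedP _ FS iF.
have /sub : w \in cnb S u by rewrite in_cnb uw (subsetP (maxdiss_sub FS)) ?orbT.
by rewrite in_cnb (negbTE wv) (negbTE (nF _ wF)) andbF.
Qed.

Lemma card_cnbU S u v : u \in nb S v -> u \notin dominated S v ->
  #|nb S v|.+2 <= #|cnb S v :|: cnb S u|.
Proof.
move=> uN; rewrite inE uN /= => /subsetPn[w wu wv].
rewrite -card_cnb; apply: (@leq_trans #|w |: cnb S v|).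
  by rewrite cardsU1 wv.
by rewrite subset_leq_card // subUset sub1set inE wu orbT subsetUl.
Qed.

(** * Components and multiplicativity *)

(** Closure under adjacency makes [C] a union of connected components, possibly several or none. *)
Definition component S C := C \subset S /\ forall x y, x \in C -> y \in S -> e x y -> y \in C.

Lemma maxdiss_exists S : exists F, F \in maxdiss S.
Proof.
have d0 : (set0 \subset S) && dissociation e set0.
  by rewrite sub0set; apply/dissociationP => x y z; rewrite in_set0.
case: (@arg_maxnP _ set0 (fun F : {set T} => (F \subset S) && dissociation e F)
        (fun F : {set T} => #|F|) d0) => F /andP[FS dF] mF.
by exists F; apply/maxdissP; split=> // F' FS' dF'; apply: mF; rewrite FS'.
Qed.

(** Union is a bijection from pairs of maximum sets of the two sides onto the maximum sets of [S]:
    sizes add, so improving one side would improve the whole. *)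
Lemma maxdiss_component S C : component S C ->
  #|maxdiss S| = #|maxdiss C| * #|maxdiss (S :\: C)|.
Proof.
case=> CS clC.
have noE x y : x \in C -> y \in S :\: C -> ~~ e x y.
  by move=> xC /setDP[yS]; apply: contra; apply: clC.
have disU (A B : {set T}) : A \subset C -> B \subset S :\: C -> dissociation e A ->
    dissociation e B -> dissociation e (A :|: B).
  move=> /subsetP sAC /subsetP sBC; apply: dissociationU => x y xA yB.
  by apply: noE; [apply: sAC | apply: sBC].
have cardU (A B : {set T}) : A \subset C -> B \subset S :\: C -> #|A :|: B| = #|A| + #|B|.
  move=> /subsetP sAC /subsetP sBC; apply/eqP; rewrite leq_card_setU disjoint_subset.
  by apply/subsetP => y yA; apply/negP => /sBC /setDP[_]; rewrite sAC.
have IC (A B : {set T}) : A \subset C -> B \subset S :\: C -> (A :|: B) :&: C = A.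
  move=> /subsetP sAC /subsetP sBC; apply/setP => y; rewrite !inE.
  apply/andP/idP => [[/orP[//|/sBC/setDP[_ /negP]]]//|yA]; by rewrite yA sAC.
have DC (A B : {set T}) : A \subset C -> B \subset S :\: C -> (A :|: B) :\: C = B.
  move=> /subsetP sAC /subsetP sBC; apply/setP => y; rewrite !inE.
  apply/andP/idP => [[/negP yC /orP[/sAC|]]//|yB].
  by rewrite yB orbT; have /setDP[_ ->] := sBC _ yB.
have IsC (F : {set T}) : F :&: C \subset C by apply: subsetIr.
have DsC (F : {set T}) : F \subset S -> F :\: C \subset S :\: C by apply: setSD.
have UsS (A B : {set T}) : A \subset C -> B \subset S :\: C -> A :|: B \subset S.
  move=> sAC sBC; rewrite subUset (subset_trans sAC) //.
  by apply: subset_trans sBC _; apply: subsetDl.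
have sdI F : dissociation e F -> dissociation e (F :&: C) by apply: dissociationS; apply: subsetIl.
have sdD F : dissociation e F -> dissociation e (F :\: C) by apply: dissociationS; apply: subsetDl.
rewrite -cardsX.
rewrite -(@card_in_imset _ _ (fun p => p.1 :|: p.2)
           (setX (maxdiss C) (maxdiss (S :\: C)))); last first.
  move=> [A B] [A' B'] /=; rewrite !in_setX => /andP[/maxdiss_sub sAC /maxdiss_sub sBC].
  move=> /andP[/maxdiss_sub sAC' /maxdiss_sub sBC'] E.
  have <- : A = A' by rewrite -(IC A B) // E IC.
  by have <- : B = B' by rewrite -(DC A B) // E DC.
apply: eq_card => F; apply/idP/imsetP => [FS|[[A B] /setXP[/= sAC sBC] ->]].
  have [FsS dF mF] := maxdissP _ _ FS.
  exists (F :&: C, F :\: C); last by rewrite /= setID.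
  apply/setXP; split; apply/maxdissP; split=> /=; auto.
    move=> F' FC' dF'; have := mF (F' :|: F :\: C).
    by rewrite UsS ?disU ?cardU ?DsC ?sdD // -[X in _ <= X](cardsID C) leq_add2r; apply.
  move=> F' FC' dF'; have := mF (F :&: C :|: F').
  by rewrite UsS ?disU ?cardU ?sdI // -[X in _ <= X](cardsID C) leq_add2l; apply.
have [AsC dA mA] := maxdissP _ _ sAC; have [BsC dB mB] := maxdissP _ _ sBC.
apply/maxdissP; split; auto.
move=> F' FS' dF'; rewrite cardU // -(cardsID C F'); apply: leq_add; auto.
Qed.

(** * Few vertices, and five vertices with ten maximum sets *)

(** All maximum sets share one cardinality [d], so they are among the [d]-subsets of [S]. *)
Lemma maxdiss_card S : exists d,
  [/\ #|maxdiss S| <= 'C(#|S|, d) &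
    forall F, F \in maxdiss S -> #|F| = d].
Proof.
have [F FS] := maxdiss_exists S; exists #|F|.
have Fd F' : F' \in maxdiss S -> #|F'| = #|F|.
  move=> FS'; have [s d m] := maxdissP _ _ FS; have [s' d' m'] := maxdissP _ _ FS'.
  by apply/eqP; rewrite eqn_leq m ?m'.
split=> //; rewrite -cards_draws; apply/subset_leq_card/subsetP => F' FS'.
by rewrite inE (maxdiss_sub FS') Fd //=.
Qed.

(** The list holds the central binomial coefficients, the largest C(m, d) for each [m]. *)
Lemma maxdiss_small S m : #|S| = m -> m <= 5 -> #|maxdiss S| <= nth 0 [:: 1; 1; 2; 3; 6; 10] m.
Proof.
move=> Sm m5; have [d [H _]] := maxdiss_card S; apply: leq_trans H _; rewrite Sm.
move: m m5 {Sm}; do 6 (case; first by case: d => [|[|[|[|[|[|d]]]]]]) => //.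
Qed.

Lemma cards3 (x y z : T) : x != y -> x != z -> y != z -> #|[set x; y; z]| = 3.
Proof.
move=> xy xz yz; rewrite setUC cardsU1 cards2 !inE xy.
by rewrite (eq_sym z x) (eq_sym z y) (negbTE xz) (negbTE yz).
Qed.

Lemma dissociation_pair F : #|F| <= 2 -> dissociation e F.
Proof.
move=> F2; apply/dissociationP => x y z xF yF zF xy xz; apply/eqP; apply: contraLR F2 => yz.
have xy' : x != y by apply: contraTneq xy => ->; rewrite e_irr.
have xz' : x != z by apply: contraTneq xz => ->; rewrite e_irr.
rewrite -ltnNge; rewrite -(cards3 xy' xz' yz).
by apply/subset_leq_card/subsetP => t; rewrite !inE => /orP[/orP[]|] /eqP->.
Qed.

(** Ten is the largest value of C(5, d), so [d] is 2 or 3 and every [d]-subset of [C] is maximum. If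
    [d] were 3, every triple and hence [C] itself would be a dissociation set. So [d] is 2 and no
    triple is one: no vertex has two non-neighbours, and the non-edges form a matching. *)
Lemma K5_minus_of_maxdiss C : #|C| = 5 -> #|maxdiss C| = 10 ->
  exists M, [/\ matching_K5 M, #|M| <= 2 & induced_iso_K5_minus e C M].
Proof.
move=> C5 mC; have [d [leC dC]] := maxdiss_card C.
have allC F : F \subset C -> #|F| = d -> F \in maxdiss C.
  have : maxdiss C = [set A : {set T} | A \subset C & #|A| == d].
    apply/eqP; rewrite eqEcard cards_draws mC C5; apply/andP; split.
      by apply/subsetP => A sAC; rewrite inE (maxdiss_sub sAC) dC //=.
    by move: d {dC leC} => [|[|[|[|[|[|d]]]]]].
  by move=> -> FC Fd; rewrite inE FC Fd eqxx.
have sub3 x y z : x \in C -> y \in C -> z \in C -> [set x; y; z] \subset C.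
  by move=> xC yC zC; apply/subsetP => t; rewrite !inE => /orP[/orP[]|] /eqP->.
have d2 : d = 2.
  have d23 : d = 2 \/ d = 3.
    move: leC; rewrite mC C5; move: d {dC allC} => [|[|[|[|[|[|d]]]]]] //; auto.
  case: d23 => // d3; exfalso.
  have : dissociation e C.
    apply/dissociationP => x y z xC yC zC xy xz; apply/eqP/negPn/negP => yz.
    have xy' : x != y by apply: contraTneq xy => ->; rewrite e_irr.
    have xz' : x != z by apply: contraTneq xz => ->; rewrite e_irr.
    have m3 : [set x; y; z] \in maxdiss C by apply: allC; rewrite ?sub3 ?cards3.
    have E : y = z by apply: (maxdiss_mate_unique m3 (x := x)); rewrite ?inE ?eqxx ?orbT.
    by rewrite E eqxx in yz.
  have [F FC] := maxdiss_exists C; have [_ _ mF] := maxdissP _ _ FC.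
  by move/(mF _ (subxx _)); rewrite C5 dC // d3.
have no3 x y z : x \in C -> y \in C -> z \in C -> x != y -> x != z -> y != z ->
    e x y || e x z.
  move=> xC yC zC xy xz yz; rewrite -[_ || _]negbK negb_or; apply/negP => /andP[nxy nxz].
  have [F FC] := maxdiss_exists C; have [_ _ mF] := maxdissP _ _ FC.
  have := mF [set x; y; z]; rewrite cards3 // dC // d2 => H.
  suff /H : dissociation e [set x; y; z] by rewrite sub3 // => /(_ isT).
  have nyx : ~~ e y x by rewrite e_sym.
  have nzx : ~~ e z x by rewrite e_sym.
  apply/dissociationP => a b c; rewrite !inE.
  move=> /orP[/orP[]|] /eqP-> /orP[/orP[]|] /eqP-> /orP[/orP[]|] /eqP->;
    by rewrite ?e_irr ?(negbTE nxy) ?(negbTE nxz) ?(negbTE nyx) ?(negbTE nzx).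
have [f fI fC] : exists2 f : 'I_5 -> T, injective f & f @: [set: 'I_5] = C.
  exists (fun i => enum_val (cast_ord (esym C5) i)).
    by move=> i j /enum_val_inj /cast_ord_inj.
  apply/setP => y; apply/imsetP/idP => [[i _ ->]|yC]; first exact: enum_valP.
  by exists (cast_ord C5 (enum_rank_in yC y)); rewrite // cast_ordK enum_rankK_in.
have fC' i : f i \in C by rewrite -fC imset_f.
(* The non-edges of [C], pulled back along the numbering [f]. *)
pose M := [set [set p.1; p.2] | p : 'I_5 * 'I_5 & (p.1 != p.2) && ~~ e (f p.1) (f p.2)].
have inM i j : i != j -> ([set i; j] \in M) = ~~ e (f i) (f j).
  move=> ij; apply/imsetP/idP => [[[p q]]|nij]; last by exists (i, j); rewrite // inE ij.
  rewrite inE /= => /andP[pq npq] E.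
  have: p \in [set i; j] by rewrite E set21.
  have: q \in [set i; j] by rewrite E set22.
  move: pq npq; rewrite !inE => pq npq /orP[]/eqP qE /orP[]/eqP pE; subst p q => //;
    by rewrite ?eqxx // e_sym in pq npq *.
have M2 : forall X, X \in M -> #|X| = 2.
  by move=> _ /imsetP[[p q] + ->] /=; rewrite inE /= cards2 => /andP[-> _].
have tM : trivIset M.
  apply/trivIsetP => X Y /imsetP[[p q] + ->] /imsetP[[p' q'] + ->] /=.
  rewrite !inE /= => /andP[pq npq] /andP[pq' npq'] XY.
  rewrite disjoint_subset; apply/subsetP => t tX; apply/negP => tY.
  have [a [aE ta nta]] : exists a, [/\ [set p; q] = [set t; a], t != a & ~~ e (f t) (f a)].
    move: tX; rewrite !inE => /orP[]/eqP->; [by exists q | exists p].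
    by rewrite setUC eq_sym e_sym.
  have [b [bE tb ntb]] : exists b, [/\ [set p'; q'] = [set t; b], t != b & ~~ e (f t) (f b)].
    move: tY; rewrite !inE => /orP[]/eqP->; [by exists q' | exists p'].
    by rewrite setUC eq_sym e_sym.
  have ab : a != b by apply: contraNneq XY => ab; rewrite aE bE ab.
  have := no3 (f t) (f a) (f b); rewrite !(inj_eq fI) !fC' ta tb ab.
  by move=> /(_ isT isT isT isT isT isT); rewrite (negbTE nta) (negbTE ntb).
exists M; split.
- by rewrite /matching_K5 tM andbT; apply/forall_inP => X /M2 ->.
(* Disjoint pairs cover 2|M| of the five indices. *)
- have := max_card (cover M); rewrite card_ord.
  have -> : #|cover M| = #|M| * 2.
    move/eqP: tM => <-; rewrite (eq_bigr (fun=> 2)) ?sum_nat_const // => X /M2 //.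
  by move=> H; rewrite -ltnS -(@ltn_pmul2r 2) // (leq_ltn_trans H).
exists f; split=> // i j; case: (eqVneq i j) => [->|ij] /=; first by rewrite e_irr.
by rewrite inM // negbK.
Qed.

(** In a triple the matching deletes at most one pair, so two edges remain and they share a vertex.
    Hence dissociation sets have at most 2 vertices, and the maximum ones are the ten pairs. *)
Lemma maxdiss_K5_minus C M : matching_K5 M -> induced_iso_K5_minus e C M ->
  #|maxdiss C| = 10.
Proof.
case/andP => _ /trivIsetP tM [f [fI fC fe]].
have C5 : #|C| = 5 by rewrite -fC card_imset // cardsT card_ord.
have le2 F : F \subset C -> dissociation e F -> #|F| <= 2.
  move=> /subsetP FC /dissociationP dF; rewrite leqNgt; apply/negP => /card_gt2P.
  case=> x [y [z [[xF yF zF] [xy yz zx]]]].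
  have fP t : t \in F -> exists i, t = f i.
    by move/FC; rewrite -fC => /imsetP[i _ ->]; exists i.
  have [i ti] := fP _ xF; have [j tj] := fP _ yF; have [k tk] := fP _ zF; subst x y z.
  rewrite !(inj_eq fI) in xy yz zx.
  have key a b c : f a \in F -> f b \in F -> f c \in F -> a != b -> b != c -> c != a ->
     ([set a; b] \notin M) || ([set a; c] \notin M).
    move=> aF bF cF ab bc ca; rewrite -negb_and; apply/negP => /andP[abM acM].
    have /(tM _ _ abM acM) : [set a; b] != [set a; c].
      apply/eqP => /setP/(_ b); rewrite !inE eqxx orbT (eq_sym b a) (negbTE ab).
      by rewrite (negbTE bc).
    by rewrite disjoint_subset => /subsetP/(_ a); rewrite !inE eqxx => /(_ isT).
  have := key i j k xF yF zF xy yz zx.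
  have := key j k i yF zF xF yz zx xy.
  have := key k i j zF xF yF zx xy yz.
  have E a b : f a \in F -> f b \in F -> a != b -> [set a; b] \notin M -> e (f a) (f b).
    by move=> _ _ ab nM; rewrite fe ab.
  have D a b c : f a \in F -> f b \in F -> f c \in F -> a != b -> b != c -> c != a ->
     ([set a; b] \notin M) -> ([set a; c] \notin M) -> False.
    move=> aF bF cF ab bc ca abM acM.
    have /fI E1 : f b = f c by apply: (dF (f a)) => //; apply: E; rewrite // eq_sym.
    by rewrite E1 eqxx in bc.
  (* Each instance of [key] excludes two deleted pairs at one vertex; together they leave two edges
     at a common vertex, against [D]. *)
  rewrite (setUC [set k]) (setUC [set j] [set i]) [[set k; j]]setUC.
  have Dijk := D i j k xF yF zF xy yz zx.
  have Djki := D j k i yF zF xF yz zx xy.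
  have Dkij := D k i j zF xF yF zx xy yz.
  rewrite (setUC [set j] [set i]) in Djki.
  rewrite (setUC [set k] [set i]) (setUC [set k] [set j]) in Dkij.
  by case/orP=> H1; case/orP => H2; case/orP => H3; auto.
have -> : maxdiss C = [set A : {set T} | A \subset C & #|A| == 2].
  apply/setP => F; rewrite [RHS]inE; apply/idP/andP => [FC|[FC /eqP F2]].
    have [FsC dF mF] := maxdissP _ _ FC; split=> //.
    rewrite eqn_leq le2 //=.
    have [A /andP[sAC /eqP A2]] : exists A : {set T}, (A \subset C) && (#|A| == 2).
      have : 0 < #|[set A : {set T} | A \subset C & #|A| == 2]| by rewrite cards_draws C5.
      by case/card_gt0P => A; rewrite inE; exists A.
    by rewrite -A2 mF // dissociation_pair ?A2.
  apply/maxdissP; split=> //; first by apply: dissociation_pair; rewrite F2.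
  by move=> F' FC' dF'; rewrite F2 le2.
by rewrite cards_draws C5.
Qed.

(** * Numerical estimates for powers of [x] *)

Local Open Scope ring_scope.

Variables (R : realFieldType) (x : R).
(* [x] is 10^(-1/5), so that [weight S] below is 10^(|S|/5). *)
Hypotheses (x_gt0 : 0 < x) (x5 : x ^+ 5 = 10%:R^-1).

(** The fifth powers of 0.63 and 0.631 lie on the two sides of 1/10. *)
Lemma x_bounds : (63 / 100 <= x) * (x <= 631 / 1000).
Proof.
split; rewrite leNgt; apply/negP => lt_x.
  have : x ^+ 5 < (63 / 100) ^+ 5 by rewrite ltr_pXn2r // ?nnegrE ?(ltW x_gt0) //; lra.
  rewrite x5; lra.
have : (631 / 1000) ^+ 5 < x ^+ 5 by rewrite ltr_pXn2r // ?nnegrE ?(ltW x_gt0) //; lra.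
rewrite x5; lra.
Qed.

(** With the factor [W] included, the branching inequalities become linear in the products of powers
    of [x] with the weight, within reach of [lra]. Apart from the first and the exact 1/10, each
    constant is 0.631 times the preceding one, rounded up. *)
Lemma x_pow_bounds (W : R) : 0 <= W ->
  [/\ x * W <= 631 / 1000 * W, x ^+ 2 * W <= 399 / 1000 * W,
      x ^+ 3 * W <= 63 / 250 * W & x ^+ 4 * W <= 4 / 25 * W] /\
  [/\ x ^+ 5 * W = 1 / 10 * W, x ^+ 6 * W <= 19 / 300 * W &
      x ^+ 7 * W <= 1 / 25 * W].
Proof.
move=> W0; have [_ xu] := x_bounds.
have step k (c d : R) : x ^+ k <= c -> 0 <= c -> 631 / 1000 * c <= d -> x ^+ k.+1 <= d.
  move=> xc c0; apply: le_trans; rewrite exprS; apply: ler_pM => //; first exact: ltW.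
  exact/exprn_ge0/ltW.
have b2 : x ^+ 2 <= 399 / 1000 by apply: (step 1%N (631 / 1000)); rewrite ?expr1 //; lra.
have b3 : x ^+ 3 <= 63 / 250 by apply: step b2 _ _; lra.
have b4 : x ^+ 4 <= 4 / 25 by apply: step b3 _ _; lra.
have b6 : x ^+ 6 <= 19 / 300 by apply: (step 5 (1 / 10)); rewrite ?x5; lra.
have b7 : x ^+ 7 <= 1 / 25 by apply: (step _ _ _ b6); lra.
by split; split; try (apply: ler_wpM2r => //; lra); rewrite x5; lra.
Qed.

(** From [n = 2] on, the ratio of consecutive terms is x(n + 1)/n, at most 3x/2 < 1. *)
Lemma natmul_pow_le m n : (1 < m <= n)%N -> n%:R * x ^+ n <= m%:R * x ^+ m.
Proof.
case/andP => m1; elim: n => [|n IH]; first by move=> /(leq_trans m1).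
rewrite leq_eqVlt => /predU1P[->//|]; rewrite ltnS => mn.
apply: le_trans (IH mn); rewrite exprS mulrA; apply: ler_wpM2r; first exact/exprn_ge0/ltW.
have [_ xu] := x_bounds.
have n2 : (2 : R) <= n%:R by rewrite ler_nat (leq_trans m1).
by rewrite -natr1; nra.
Qed.

(** The sequence rises up to [n = 2], because 2x exceeds 1, and falls afterwards. *)
Lemma natmul_pow_le2 n : n%:R * x ^+ n <= 2 * x ^+ 2.
Proof.
have [xl xu] := x_bounds.
case: n => [|[|n]]; last exact: natmul_pow_le.
  by rewrite mul0r mulr_ge0 // exprn_ge0 // ltW.
by rewrite mul1r expr1 expr2; nra.
Qed.

(** * Weights and the bound for each branch *)

Definition weight S : R := x^-1 ^+ #|S|.
(** The induction hypothesis of the whole argument, made an explicit premise so that the local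
    lemmas need no induction of their own. *)
Definition smaller_bounded S :=
  forall S', S' \proper S -> (#|maxdiss S'|)%:R <= weight S'.

Lemma weight_gt0 S : 0 < weight S.
Proof. by rewrite exprn_gt0 // invr_gt0. Qed.

Lemma weightD S D : D \subset S -> weight (S :\: D) = x ^+ #|D| * weight S.
Proof.
move=> DS; rewrite /weight -(cardsID D S) (setIidPr DS) exprD mulrA -exprMn divff.
  by rewrite expr1n mul1r.
by rewrite gt_eqF.
Qed.

(** The induction hypothesis gives x^|D| times the weight for what survives outside [D]. As x < 1, a
    lower estimate [k] of |D| suffices, and its positivity makes the remainder a proper subset. *)
Lemma deleted_le S n D k : smaller_bounded S ->
  (n <= #|maxdiss (S :\: D)|)%N -> D \subset S ->
  (0 < k <= #|D|)%N -> n%:R <= x ^+ k * weight S.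
Proof.
move=> IH nle DS /andP[k0 kD].
apply: (@le_trans _ _ (weight (S :\: D))).
  apply: le_trans (_ : _ <= (#|maxdiss (S :\: D)|)%:R) _; first by rewrite ler_nat.
  apply: IH.
  rewrite properE subsetDl /=; apply/subsetPn.
  have /card_gt0P[v vD] : (0 < #|D|)%N by apply: leq_trans kD.
  by exists v; [apply: (subsetP DS) | rewrite inE vD].
rewrite weightD // ler_pM2r ?weight_gt0 // ler_wiXn2l //; first exact: ltW.
have [_ xu] := x_bounds; lra.
Qed.

Lemma avoids_le S v : smaller_bounded S -> v \in S -> (cnt S (avoids v))%:R <= x * weight S.
Proof.
move=> IH vS; rewrite -[x]expr1; apply: (deleted_le IH (cnt_avoids S v)).
  by rewrite sub1set.
by rewrite cards1.
Qed.

Lemma isolated_le S v k : smaller_bounded S -> v \in S -> (0 < k <= #|nb S v|.+1)%N ->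
  (cnt S (isolated S v))%:R <= x ^+ k * weight S.
Proof.
by move=> IH vS kle; apply: (deleted_le IH (cnt_isolated S v)); rewrite ?cnb_sub // card_cnb.
Qed.

Lemma mated_le S u v k : smaller_bounded S -> u \in S -> v \in S ->
  (0 < k <= #|cnb S u :|: cnb S v|)%N ->
  (cnt S (mated S u v))%:R <= x ^+ k * weight S.
Proof.
by move=> IH uS vS kle; apply: (deleted_le IH (cnt_mated S u v)); rewrite // subUset !cnb_sub.
Qed.

Lemma exists_le S A (Q : T -> pred {set T}) (b : R) :
    (forall u, u \in A -> (cnt S (Q u))%:R <= b) ->
  (cnt S (fun F => [exists u in A, Q u F]))%:R <= #|A|%:R * b.
Proof.
move=> Qb; apply: (@le_trans _ _ (\sum_(u in A) cnt S (Q u))%:R).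
  by rewrite ler_nat cnt_exists.
rewrite natr_sum mulr_natl -sumr_const; exact: ler_sum.
Qed.

(** For d the degree of [v], a dominated neighbour guarantees only the d + 1 vertices of N[v]; any
    other one brings a vertex outside N[v], hence d + 2. *)
Lemma exists_mated_le S v : smaller_bounded S -> v \in S ->
  (cnt S (fun F => [exists u in nb S v, mated S v u F]))%:R <=
    #|dominated S v|%:R * (x ^+ #|nb S v|.+1 * weight S)
    + #|nb S v :\: dominated S v|%:R * (x ^+ #|nb S v|.+2 * weight S).
Proof.
move=> IH vS.
have le2 : (cnt S (fun F => [exists u in nb S v, mated S v u F]) <=
   cnt S (fun F => [exists u in dominated S v, mated S v u F])
   + cnt S (fun F => [exists u in nb S v :\: dominated S v, mated S v u F]))%N.
  apply: cntU => F FS /exists_inP[u uN mu]; apply/orP.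
  case: (boolP (u \in dominated S v)) => ud; [left | right]; apply/exists_inP; exists u => //.
  by rewrite in_setD ud.
move: le2; rewrite -(ler_nat R) natrD => /le_trans; apply; apply: lerD; apply: exists_le => u.
  rewrite inE => /andP[]; rewrite in_nb => /andP[uS _] _; apply: mated_le => //.
  by rewrite ltn0Sn -card_cnb subset_leq_card ?subsetUl.
case/setDP => uN ud; have := uN; rewrite in_nb => /andP[uS _].
by apply: mated_le; rewrite // card_cnbU.
Qed.

(** * Degrees at most 1, at least 5, and equal to 4 *)

(** For a leaf [v] with neighbour [u], branch at [u]: if [u] is absent then [v] is isolated, giving
    x^2; [u] is never isolated, since [v] is dominated by it; and [u] mated gives d x^(d + 1), at
    most 2 x^3, for d the degree of [u]. A vertex of degree 0 lies in every maximum set, giving x.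
    The bound stays explicit because it is used again after a deletion. *)
Lemma low_degree S v : smaller_bounded S -> v \in S -> (#|nb S v| <= 1)%N ->
  (#|maxdiss S|)%:R <= (x ^+ 2 + 2 * x ^+ 3) * weight S.
Proof.
move=> IH vS; have [xl xu] := x_bounds; have W0 := weight_gt0 S.
rewrite leq_eqVlt ltnS leqn0 => /orP[/cards1P[u nbv]|/eqP/cards0_eq nbv].
  have : u \in nb S v by rewrite nbv set11.
  rewrite in_nb => /andP[uS vu].
  have onlyu p : p \in S -> e v p -> p = u.
    by move=> pS vp; apply/set1P; rewrite -nbv in_nb pS.
  have av : (cnt S (avoids u) <= cnt S (isolated S v))%N.
    apply: cnt_le => F FS; rewrite avoidsE => uF.
    have /subsetP sFS := maxdiss_sub FS.
    apply/isolatedP => //; split; last first.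
      by move=> p pF; apply: contra uF => vp; rewrite -(onlyu p) ?sFS.
    apply: contraNT uF => vF.
    by have [p [q [pF _ vp _]]] := maxdiss_ext FS vS vF; rewrite -(onlyu p) ?sFS.
  have dv : dominated S u != set0.
    apply/set0Pn; exists v; rewrite inE in_nb vS e_sym vu /=.
    apply/subsetP => y; rewrite !in_cnb => /predU1P[->|/andP[yS vy]].
      by rewrite vS e_sym vu orbT.
    by rewrite (onlyu y) ?eqxx.
  have := branch uS; rewrite (isolated_dominated0 dv) addn0 -(ler_nat R) natrD => /le_trans; apply.
  rewrite mulrDl; apply: lerD.
    apply: (@le_trans _ _ (cnt S (isolated S v))%:R); first by rewrite ler_nat.
    by apply: (isolated_le IH); rewrite // nbv cards1.
  apply: le_trans (exists_le (b := x ^+ #|nb S u|.+1 * weight S) _) _.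
    move=> p; rewrite in_nb => /andP[pS _]; apply: mated_le => //.
    by rewrite ltn0Sn -card_cnb subset_leq_card ?subsetUl.
  rewrite mulrA ler_pM2r // (exprS x #|nb S u|) (exprS x 2) !(mulrCA _ x) ler_pM2l //.
  by rewrite mulrCA -expr2; apply: natmul_pow_le2.
rewrite cnt_all.
apply: (@le_trans _ _ (cnt S (isolated S v))%:R).
  rewrite ler_nat; apply: cnt_le => F FS _; have /subsetP sFS := maxdiss_sub FS.
  have nov p : p \in F -> ~~ e v p.
    move=> pF; apply/negP => vp; have : p \in nb S v by rewrite in_nb sFS.
    by rewrite nbv in_set0.
  apply/isolatedP => //; split=> //; apply/negPn/negP => vF.
  by have [p [q [/nov/negP]]] := maxdiss_ext FS vS vF.
apply: le_trans (isolated_le (k := 1) IH vS _) _ => //.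
by rewrite ler_pM2r // expr1 !exprS expr0; nra.
Qed.

Lemma branch_le S v : smaller_bounded S -> v \in S ->
  (#|maxdiss S|)%:R <= x * weight S + (cnt S (isolated S v))%:R +
    (#|dominated S v|%:R * (x ^+ #|nb S v|.+1 * weight S)
     + #|nb S v :\: dominated S v|%:R * (x ^+ #|nb S v|.+2 * weight S)).
Proof.
move=> IH vS; have := branch vS; rewrite -(ler_nat R) !natrD => /le_trans; apply.
apply: lerD; first by rewrite lerD2r (avoids_le IH).
exact (exists_mated_le IH vS).
Qed.

Lemma low_degree_lt S v : smaller_bounded S -> v \in S -> (#|nb S v| <= 1)%N ->
  (#|maxdiss S|)%:R < weight S.
Proof.
move=> IH vS d1; apply: le_lt_trans (low_degree IH vS d1) _.
have W0 := weight_gt0 S; have [[_ b2 b3 _] _] := x_pow_bounds (ltW W0).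
rewrite mulrDl -mulrA; lra.
Qed.

Lemma dominated_sub S v : dominated S v \subset nb S v.
Proof. by apply/subsetP => u; rewrite inE => /andP[]. Qed.

Lemma card_nb_dominated S v : (#|dominated S v| + #|nb S v :\: dominated S v|)%N = #|nb S v|.
Proof. by rewrite -[RHS](cardsID (dominated S v)) (setIidPr (dominated_sub S v)). Qed.

Lemma mated_terms_le S v :
  #|dominated S v|%:R * (x ^+ #|nb S v|.+1 * weight S)
     + #|nb S v :\: dominated S v|%:R * (x ^+ #|nb S v|.+2 * weight S) <=
  #|nb S v|%:R * (x ^+ #|nb S v|.+1 * weight S).
Proof.
rewrite -[in X in _ <= X%:R * _](card_nb_dominated S v) natrD mulrDl lerD2l.
apply: ler_wpM2l => //; rewrite ler_pM2r ?weight_gt0 //.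
have [_ xu] := x_bounds; apply: ler_wiXn2l => //; first exact: ltW.
by lra.
Qed.

(** For d = 5 the sum is x + x^6 + 5 x^7 without dominated neighbours and at most x + 5 x^6
    otherwise. For larger d it is at most x + (d + 1) x^(d + 1), whose last term is at most 7
    x^7. *)
Lemma high_degree_lt S v : smaller_bounded S -> v \in S -> (5 <= #|nb S v|)%N ->
  (#|maxdiss S|)%:R < weight S.
Proof.
move=> IH vS d5; have W0 := weight_gt0 S.
have [[b1 _ _ _] [b5 b6 b7]] := x_pow_bounds (ltW W0).
apply: le_lt_trans (branch_le IH vS) _.
have cap := mated_terms_le S v.
have iso : (cnt S (isolated S v))%:R <= x ^+ #|nb S v|.+1 * weight S.
  by apply: (isolated_le IH vS); rewrite ltn0Sn leqnn.
move: d5; rewrite leq_eqVlt => /predU1P[d5|d6].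
  have [d0|dn0] := eqVneq (dominated S v) set0.
    by move: iso; have := card_nb_dominated S v; rewrite d0 cards0 add0n => ->; rewrite -d5; lra.
  by move: cap; rewrite (isolated_dominated0 dn0) -d5; lra.
have := @natmul_pow_le 7 #|nb S v|.+1 d6.
rewrite -(ler_pM2r W0) -[X in X <= _]mulrA -[X in _ <= X]mulrA -natr1 mulrDl mul1r; lra.
Qed.

Lemma dominated_full_component S v : v \in S -> dominated S v = nb S v -> component S (cnb S v).
Proof.
move=> vS E; split; first exact: cnb_sub.
move=> a b; rewrite in_cnb => /predU1P[->|aN] bS ab; first by rewrite in_cnb bS ab orbT.
have : a \in dominated S v by rewrite E in_nb.
by rewrite inE => /andP[_ /subsetP]; apply; rewrite in_cnb bS ab orbT.
Qed.

Lemma dominated_fullP S v : #|dominated S v| = #|nb S v| -> dominated S v = nb S v.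
Proof. by move=> E; apply/eqP; rewrite eqEcard dominated_sub E leqnn. Qed.

(** Without dominated neighbours the sum is x + x^5 + 4 x^6; with j of them, 1 to 3, it is x + j x^5
    + (4 - j) x^6. If all four are dominated, no edge leaves N[v]. *)
Lemma degree4 S v : smaller_bounded S -> v \in S -> #|nb S v| = 4%N ->
  (#|maxdiss S|)%:R < weight S \/ component S (cnb S v).
Proof.
move=> IH vS d4; have W0 := weight_gt0 S.
have [[b1 _ _ _] [b5 b6 b7]] := x_pow_bounds (ltW W0).
have H := branch_le IH vS; have C := card_nb_dominated S v.
have iso0 := @isolated_dominated0 S v.
have iso : (cnt S (isolated S v))%:R <= x ^+ 5 * weight S by apply: (isolated_le IH vS); rewrite d4.
move: C H iso0 iso (@dominated_fullP S v); rewrite d4.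
move DE : #|dominated S v| => [|[|[|[|[|j]]]]]; last by rewrite !addSn.
- rewrite add0n => -> H _ iso _; left; lra.
- by rewrite -cards_eq0 DE !addSn add0n => -[->] H i0 _ _; left; rewrite i0 // in H; lra.
- by rewrite -cards_eq0 DE !addSn add0n => -[->] H i0 _ _; left; rewrite i0 // in H; lra.
- by rewrite -cards_eq0 DE !addSn add0n => -[->] H i0 _ _; left; rewrite i0 // in H; lra.
- by move=> _ _ _ _ /(_ erefl) /(dominated_full_component vS); right.
Qed.

(** * Components of order 3 or 4, and vertices of degree 3 *)

(** By multiplicativity the factor before the weight is at most 3 x^3 or 6 x^4, both below 1. *)
Lemma small_component_lt S C : smaller_bounded S -> component S C ->
  (#|C| == 3) || (#|C| == 4) -> (#|maxdiss S|)%:R < weight S.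
Proof.
move=> IH cC C34; have W0 := weight_gt0 S; have [CS _] := cC.
have [[b1 b2 b3 b4] _] := x_pow_bounds (ltW W0).
rewrite (maxdiss_component cC) natrM.
have C0 : (0 < #|C| <= #|C|)%N by case/orP: C34 => /eqP->.
have rest := deleted_le IH (leqnn _) CS C0.
case/orP: C34 => /eqP C34; rewrite C34 in rest.
  have := maxdiss_small C34 isT; rewrite -(ler_nat R) /= => le3.
  apply: le_lt_trans (ler_pM _ _ le3 rest) _ => //; lra.
have := maxdiss_small C34 isT; rewrite -(ler_nat R) /= => le6.
apply: le_lt_trans (ler_pM _ _ le6 rest) _ => //; lra.
Qed.

(* The set must contain [w], since otherwise [u] could be added to it; the status of [w] then
   gives (k + 1) x^(5 + k) with k the number of neighbours of [w] outside N[v]. *)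
Lemma forced_isolated_le S u v w : smaller_bounded S -> v \in S -> #|nb S v| = 3%N ->
    u \in nb S v -> w \in S -> w \notin cnb S v ->
    (forall y, y \in nb S u -> y \in cnb S v \/ y = w) ->
  (cnt S (isolated S v))%:R <= 2 * x ^+ 6 * weight S.
Proof.
move=> IH vS d3 uN wS wv uw.
pose K := nb S w :\: cnb S v.
have cardD : (5 + #|K| <= #|cnb S v :|: cnb S w|)%N.
  have -> : (5 + #|K| = #|cnb S v| + (1 + #|K|))%N by rewrite card_cnb d3 addnA.
  have <- : #|w |: K| = (1 + #|K|)%N by rewrite cardsU1 in_setD in_nb e_irr !andbF.
  have -> : (#|cnb S v| + #|w |: K|)%N = #|cnb S v :|: (w |: K)|.
    apply/esym/eqP; rewrite leq_card_setU disjoint_sym disjoint_subset.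
    apply/subsetP => y; rewrite in_setU1 in_setD => /predU1P[->|/andP[yv _]] //.
  apply/subset_leq_card/setUS/subsetP => y; rewrite in_setU1 in_setD in_nb (in_cnb S w).
  by case: eqP => //= _ /andP[_ ->].
have wF F : F \in maxdiss S -> isolated S v F -> w \in F.
  move=> FS iF; have [z zF /andP[uz zv]] := isolated_other_nb FS iF uN.
  have zS := subsetP (maxdiss_sub FS) _ zF; have [_ nF] := isolatedP _ FS iF.
  have /uw : z \in nb S u by rewrite in_nb zS.
  by case=> [|<- //]; rewrite in_cnb (negbTE zv) (negbTE (nF _ zF)) andbF.
(* The two cases for [w]: isolated, or mated to some [z], which lies outside N[v] because [v] is
   isolated and not adjacent to [w]. *)
pose P0 : pred {set T} := fun F => F :&: (cnb S v :|: cnb S w) == [set v] :|: [set w].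
pose Pz z : pred {set T} := fun F =>
  F :&: (cnb S v :|: (cnb S w :|: cnb S z)) == [set v] :|: [set w; z].
have split2 : (cnt S (isolated S v) <= cnt S P0 + cnt S (fun F => [exists z in K, Pz z F]))%N.
  apply: cntU => F FS iF; have wFF := wF _ FS iF.
  case/orP: (in_maxdissP FS wFF) => [iw|/exists_inP[z zN mz]]; apply/orP; [left|right].
    by rewrite /P0 setIUr (eqP iF) (eqP iw).
  apply/exists_inP; exists z; last by rewrite /Pz setIUr (eqP iF) (eqP mz).
  have wz : e w z by move: zN; rewrite in_nb => /andP[].
  have [_ zF] := matedP FS wz mz; have [_ nF] := isolatedP _ FS iF.
  rewrite in_setD zN andbT in_cnb negb_or negb_and (nF _ zF) orbT andbT.
  apply: contraTneq wz => ->; apply/negP => wv'.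
  by move: wv; rewrite in_cnb wS e_sym wv' orbT.
have sub2 (A B : {set T}) : A \subset S -> B \subset S -> A :|: B \subset S.
  by move=> As Bs; apply/subUsetP.
have K0 : (0 < 5 + #|K|)%N by [].
have P0le : (cnt S P0)%:R <= x ^+ (5 + #|K|) * weight S.
  apply: (deleted_le IH (D := cnb S v :|: cnb S w)).
  - apply: cnt_trace => a b /setUP[/set1P|/set1P] -> bS ab; rewrite inE !in_cnb bS ab !orbT //.
  - by rewrite sub2 ?cnb_sub.
  - by rewrite K0 cardD.
have Pzle z : z \in K -> (cnt S (Pz z))%:R <= x ^+ (5 + #|K|) * weight S.
  rewrite in_setD in_nb => /and3P[_ zS wz].
  apply: (deleted_le IH (D := cnb S v :|: (cnb S w :|: cnb S z))).
  - apply: cnt_trace => a b /setUP[/set1P|/set2P[]] -> bS ab; rewrite !(inE, in_cnb) bS ab !orbT //.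
  - apply: (sub2); first exact: cnb_sub.
    by apply: (sub2); apply: cnb_sub.
  - by rewrite K0 (leq_trans cardD) // setUA subset_leq_card // subsetUl.
move: split2; rewrite -(ler_nat R) natrD => /le_trans; apply.
apply: le_trans (lerD P0le (exists_le Pzle)) _.
rewrite -[X in X + _]mul1r -mulrDl mulrA ler_pM2r ?weight_gt0 //.
(* Splitting off x^4 leaves (k + 1) x^(k + 1), at most 2 x^2. *)
have -> : (5 + #|K| = 4 + #|K|.+1)%N by rewrite addnS.
rewrite exprD -[6%N]/(4 + 2)%N exprD !(mulrCA _ (x ^+ 4)).
rewrite ler_pM2l ?exprn_gt0 // addrC natr1.
exact: natmul_pow_le2.
Qed.

Lemma smaller_boundedS S S' : S' \subset S -> smaller_bounded S -> smaller_bounded S'.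
Proof. by move=> S'S IH S'' H; apply: IH; apply: proper_sub_trans H S'S. Qed.

(** Once [v] is deleted, [u] has degree at most 1, so [low_degree] improves the plain bound by the
    factor x^2 + 2 x^3. *)
Lemma avoids_low_le S v u : smaller_bounded S -> v \in S -> u \in nb S v ->
  (#|nb S u| <= 2)%N -> (cnt S (avoids v))%:R <= (x ^+ 2 + 2 * x ^+ 3) * (x * weight S).
Proof.
move=> IH vS uN d2.
have E : weight (S :\ v) = x * weight S by rewrite weightD ?sub1set // cards1 expr1.
rewrite -E; apply: (@le_trans _ _ (#|maxdiss (S :\ v)|)%:R).
  by rewrite ler_nat cnt_avoids.
have [uS vu] : u \in S /\ e v u by move: uN; rewrite in_nb => /andP.
apply: (low_degree (v := u)).
- by apply: smaller_boundedS IH; apply: subsetDl.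
- by rewrite !inE uS andbT; apply: contraTneq vu => ->; rewrite e_irr.
have <- : nb S u :\ v = nb (S :\ v) u.
  by apply/setP => y; rewrite !inE andbA.
by move: d2; rewrite (cardsD1 v) in_nb vS e_sym vu.
Qed.

Lemma avoids_low_num_le S v u : smaller_bounded S -> v \in S -> u \in nb S v ->
  (#|nb S u| <= 2)%N -> (cnt S (avoids v))%:R <= 63 / 250 * weight S + 2 * (4 / 25 * weight S).
Proof.
move=> IH vS uN d2; apply: le_trans (avoids_low_le IH vS uN d2) _.
have [[_ _ b3 b4] _] := x_pow_bounds (ltW (weight_gt0 S)).
have -> : (x ^+ 2 + 2 * x ^+ 3) * (x * weight S) = x ^+ 3 * weight S + 2 * (x ^+ 4 * weight S).
  by ring.
lra.
Qed.

(* With two dominated neighbours, one of them has degree 2 and becomes a leaf once [v] is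
   deleted: otherwise both are adjacent to the third neighbour, giving it degree 4. *)
Lemma degree3_dominated S v : smaller_bounded S -> v \in S -> #|nb S v| = 3%N ->
    (forall u, u \in S -> #|nb S u| <= 3)%N -> dominated S v != set0 ->
  (#|maxdiss S|)%:R < weight S.
Proof.
move=> IH vS d3 max3 dn0; have W0 := weight_gt0 S.
have [[b1 _ b3 b4] [b5 b6 b7]] := x_pow_bounds (ltW W0).
have H := branch_le IH vS; have C := card_nb_dominated S v.
move: H C; rewrite (isolated_dominated0 dn0) d3; move: dn0; rewrite -cards_eq0.
move DE : #|dominated S v| => [|[|[|[|j]]]]; rewrite ?addSn ?add0n // => _ H.
(* One dominated neighbour: x + x^4 + 2 x^5, at most 0.991. *)
- by case=> E; rewrite E in H; lra.
- case=> E.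
  case: (boolP [exists u in dominated S v, #|nb S u| <= 2]%N) => [/exists_inP[u ud u2]|].
    have uN := subsetP (dominated_sub S v) _ ud.
    have av := avoids_low_num_le IH vS uN u2.
    have := branch vS; rewrite -(ler_nat R) !natrD.
    rewrite (isolated_dominated0 (v := v)) => [H2|]; last first.
      by apply/set0Pn; exists u.
    have := exists_mated_le IH vS; rewrite E DE d3 => H3.
    by apply: le_lt_trans H2 _; lra.
  move/exists_inPn => nE; exfalso.
  have [c cD] : exists c, c \in nb S v :\: dominated S v by apply/card_gt0P; rewrite E.
  have [cN cd] : c \in nb S v /\ c \notin dominated S v by move: cD; rewrite in_setD => /andP[].
  have [cS vc] : c \in S /\ e v c by move: cN; rewrite in_nb => /andP.
  (* A dominated vertex of degree 3 is adjacent to all the rest of N[v]. *)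
  have domc a : a \in dominated S v -> e c a.
    move=> ad; have := nE _ ad; rewrite -ltnNge => a3.
    have aN := subsetP (dominated_sub S v) _ ad.
    have sub : nb S a \subset cnb S v :\ a.
      apply/subsetP => y; move: ad; rewrite inE => /andP[_ /subsetP sub] yN.
      rewrite in_setD1; apply/andP; split.
        by apply: contraTneq yN => ->; rewrite in_nb e_irr andbF.
      by apply: sub; rewrite in_cnb -in_nb yN orbT.
    have c3 : #|cnb S v :\ a| = 3%N.
      by have := cardsD1 a (cnb S v); rewrite card_cnb d3 in_cnb -in_nb aN orbT => -[].
    have : c \in nb S a.
      have /eqP -> : nb S a == cnb S v :\ a by rewrite eqEcard sub c3.
      rewrite in_setD1 in_cnb -in_nb cN orbT andbT.
      by apply: contraNneq cd => ->.
    by rewrite in_nb e_sym => /andP[].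
  have [w wc wv] : exists2 w, w \in cnb S c & w \notin cnb S v.
    by move: cd; rewrite inE cN => /subsetPn.
  have : (#|v |: (w |: dominated S v)| <= #|nb S c|)%N.
    apply/subset_leq_card/subsetP => y; rewrite in_nb.
    case/setU1P => [->|/setU1P[->|yd]]; first by rewrite vS e_sym.
      move: wc; rewrite in_cnb => /predU1P[wc|//].
      by move: wv; rewrite wc in_cnb cS vc orbT.
    by rewrite domc // andbT; have := subsetP (dominated_sub S v) _ yd; rewrite in_nb => /andP[].
  rewrite cardsU1 cardsU1 DE.
  have -> : w \notin dominated S v.
    by apply: contra wv => /(subsetP (dominated_sub S v)); rewrite in_cnb -in_nb orbC => ->.
  have -> : v \notin w |: dominated S v.
    rewrite in_setU1 negb_or; apply/andP; split.
      by apply: contraNneq wv => <-; rewrite in_cnb eqxx.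
    by apply/negP => /(subsetP (dominated_sub S v)); rewrite in_nb e_irr andbF.
  by move/leq_trans/(_ (max3 _ cS)).
- move=> _; have /(dominated_full_component vS) : dominated S v = nb S v.
    by apply: dominated_fullP; rewrite DE d3.
  by move/small_component_lt; apply; rewrite // card_cnb d3.
Qed.

(** The vertex [u] helps twice: its other neighbour lies outside N[v], so [forced_isolated_le] gives
    2 x^6 for [v] isolated, and it becomes a leaf when [v] is deleted. The sum x^3 + 2 x^4 + 2 x^6 +
    3 x^5 is below 0.999. *)
Lemma degree3_degree2 S v u : smaller_bounded S -> v \in S -> #|nb S v| = 3%N ->
    dominated S v = set0 -> u \in nb S v -> #|nb S u| = 2%N ->
  (#|maxdiss S|)%:R < weight S.
Proof.
move=> IH vS d3 d0 uN u2; have W0 := weight_gt0 S.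
have [_ [b5 b6 b7]] := x_pow_bounds (ltW W0).
have [uS vu] : u \in S /\ e v u by move: uN; rewrite in_nb => /andP.
have ud : u \notin dominated S v by rewrite d0 in_set0.
have [w wu wv] : exists2 w, w \in cnb S u & w \notin cnb S v.
  by move: ud; rewrite inE uN => /subsetPn.
have wN : w \in nb S u.
  move: wu; rewrite in_cnb -in_nb => /predU1P[E|//].
  by move: wv; rewrite E in_cnb uS vu orbT.
have [wS uw] : w \in S /\ e u w by move: wN; rewrite in_nb => /andP.
have vw : v != w by apply: contraNneq wv => <-; rewrite in_cnb eqxx.
have Eu : nb S u = [set v; w].
  apply/esym/eqP; rewrite eqEcard cards2 vw u2 andbT.
  by apply/subsetP => y /set2P[]->; rewrite // in_nb vS e_sym.
have iso : (cnt S (isolated S v))%:R <= 2 * x ^+ 6 * weight S.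
  apply: (forced_isolated_le IH vS d3 uN wS wv) => y; rewrite Eu.
  by case/set2P => ->; [left; rewrite in_cnb eqxx | right].
have av := avoids_low_num_le IH vS uN (eq_leq u2).
have := branch vS; rewrite -(ler_nat R) !natrD => H2.
have := exists_mated_le IH vS; have := card_nb_dominated S v.
rewrite d0 cards0 add0n d3 => -> H3.
by apply: le_lt_trans H2 _; lra.
Qed.

(** * The cubic case *)

Lemma cnt_cover S (Ps : seq (pred {set T})) :
    (forall F, F \in maxdiss S -> has (fun P : pred {set T} => P F) Ps) ->
  (#|maxdiss S|)%:R <= \sum_(P <- Ps) (cnt S P)%:R :> R.
Proof.
move=> cov; rewrite cnt_all -natr_sum ler_nat.
have : forall F, F \in maxdiss S -> predT F -> has (fun P : pred {set T} => P F) Ps.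
  by move=> F /cov.
(* The predicate is generalised because each step of the induction discards the sets already
   covered. *)
move: (predT) {cov}; elim: Ps => [|P Ps IHs] Q cov.
  rewrite big_nil leqn0 cards_eq0; apply/eqP/setP => F; rewrite in_sel in_set0.
  by apply/negP => /andP[FS /(cov _ FS)].
rewrite big_cons; apply: leq_trans (cntU (P1 := P) (P2 := predD Q P) _) _.
  by move=> F FS QF /=; case: (P F).
rewrite leq_add2l; apply: IHs => F FS /= /andP[nP /(cov _ FS)] /=.
by rewrite (negbTE nP).
Qed.

Lemma third_element (A : {set T}) a b : #|A| = 3%N -> a \in A -> b \in A -> a != b ->
  exists c, [/\ c \in A, c != a, c != b & A = [set a; b; c]].
Proof.
move=> A3 aA bA ab.
have sub : [set a; b] \subset A by apply/subsetP => y /set2P[]->.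
have /cards1P[c cE] : #|A :\: [set a; b]| == 1.
  by rewrite cardsD (setIidPr sub) A3 cards2 ab.
have : c \in A :\: [set a; b] by rewrite cE set11.
rewrite !inE negb_or => /andP[/andP[ca cb] cA]; exists c; split=> //.
by rewrite -(setID A [set a; b]) cE (setIidPr sub).
Qed.

(** If [b] and [o] were adjacent, N[a] and N[b] would both be {a, b, c, o}, and [a] would dominate
    [b]. *)
Lemma triangle_outer_nb S a b c o : a \in S -> b \in S -> c \in S ->
    e a b -> e b c -> e a c ->
    #|nb S b| = 3%N -> dominated S a = set0 -> nb S a = [set b; c; o] -> o != c -> ~~ e b o.
Proof.
move=> aS bS cS ab bc ac b3 d0 Ea oc; apply/negP => bo.
have /andP[oS ao] : (o \in S) && e a o by rewrite -in_nb Ea !inE eqxx orbT.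
have Eb : nb S b = [set a; c; o].
  apply/esym/eqP; rewrite eqEcard b3 cards3 ?leqnn ?andbT.
  - by apply/subsetP => y; rewrite in_nb => /setUP[/set2P[]|/set1P] ->;
      rewrite ?aS ?cS ?oS ?bc ?bo // e_sym.
  - by apply: contraTneq ac => ->; rewrite e_irr.
  - by apply: contraTneq ao => ->; rewrite e_irr.
  - by rewrite eq_sym.
have : b \in dominated S a.
  rewrite inE in_nb bS ab /=; apply/subsetP => y; rewrite !in_cnb -!in_nb Eb Ea !inE.
  by case/predU1P=> [->|/orP[/orP[]|]/eqP->]; rewrite ?eqxx ?orbT.
by rewrite d0 in_set0.
Qed.

(* The weights sum to 3x^5 + 11x^6 < 1: two vertices of the triangle mated; one of them mated
   with its outer neighbour; one of them isolated; none of them in the set, in which case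
   [oa] must be mated. *)
Lemma cubic_triangle S a b c oa ob oc : smaller_bounded S ->
    a \in S -> b \in S -> c \in S -> e a b -> e a c -> e b c ->
    (forall v, v \in S -> #|nb S v| = 3%N -> dominated S v = set0) ->
    nb S a = [set b; c; oa] -> nb S b = [set c; a; ob] -> nb S c = [set a; b; oc] ->
    oa != b -> oa != c -> ob != c -> ob != a -> oc != a -> oc != b ->
    #|nb S oa| = 3%N -> #|nb S ob| = 3%N -> #|nb S oc| = 3%N ->
  (#|maxdiss S|)%:R < weight S.
Proof.
move=> IH aS bS cS ab ac bc D0 Ea Eb Ec oab oac obc oba oca ocb oa3 ob3 oc3.
have [ba ca cb] : [/\ e b a, e c a & e c b] by rewrite !(e_sym c) (e_sym b).
have ne u v : e u v -> u != v by apply: contraTneq => ->; rewrite e_irr.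
have a3 : #|nb S a| = 3%N by rewrite Ea cards3 ?(ne _ _ bc) 1?eq_sym ?oab ?oac.
have b3 : #|nb S b| = 3%N by rewrite Eb cards3 ?(ne _ _ ca) 1?eq_sym ?obc ?oba.
have c3 : #|nb S c| = 3%N by rewrite Ec cards3 ?(ne _ _ ab) 1?eq_sym ?oca ?ocb.
have mem (t p q o : T) : nb S t = [set p; q; o] -> o \in S /\ e t o.
  by move=> E; apply/andP; rewrite -in_nb E !inE eqxx !orbT.
have [oaS aoa] := mem _ _ _ _ Ea; have [obS bob] := mem _ _ _ _ Eb.
have [ocS coc] := mem _ _ _ _ Ec.
have swap (p q o : T) : [set p; q; o] = [set q; p; o] by rewrite (setUC [set p]).
have n_boa : ~~ e b oa by apply: triangle_outer_nb Ea _ => //; rewrite ?D0.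
have n_coa : ~~ e c oa by rewrite swap in Ea; apply: triangle_outer_nb Ea _ => //; rewrite ?D0.
have n_cob : ~~ e c ob by apply: triangle_outer_nb Eb _ => //; rewrite ?D0.
have n_aob : ~~ e a ob by rewrite swap in Eb; apply: triangle_outer_nb Eb _ => //; rewrite ?D0.
have n_aoc : ~~ e a oc by apply: triangle_outer_nb Ec _ => //; rewrite ?D0.
have n_boc : ~~ e b oc by rewrite swap in Ec; apply: triangle_outer_nb Ec _ => //; rewrite ?D0.
have pair t u : t \in S -> u \in S -> e t u -> #|nb S t| = 3%N ->
    (cnt S (mated S t u))%:R <= x ^+ 5 * weight S.
  move=> tS uS tu t3; apply: mated_le => //.
  by have := @card_cnbU S u t; rewrite in_nb uS tu D0 // in_set0 t3 => ->.
have iso t u o : t \in S -> u \in S -> e t u -> #|nb S t| = 3%N -> o \in S ->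
    (exists p, e t p /\ nb S u = [set p; t; o]) -> ~~ e t o -> o != t ->
    (cnt S (isolated S t))%:R <= 2 * x ^+ 6 * weight S.
  move=> tS uS tu t3 oS [p [tp Eu]] nto ot.
  have /andP[pS _] : (p \in S) && e u p by rewrite -in_nb Eu !inE eqxx.
  apply: (forced_isolated_le (u := u) (w := o)) => //.
  - by rewrite in_nb uS.
  - by rewrite in_cnb negb_or ot negb_and nto orbT.
  move=> y; rewrite Eu => /setUP[/set2P[]|/set1P] ->; [left|left|by right].
    by rewrite in_cnb pS tp orbT.
  by rewrite in_cnb eqxx.
have six p q o : p != q -> ~~ e p o -> ~~ e q o -> o != p -> o != q -> #|nb S o| = 3%N ->
    #|[set p; q] :|: cnb S o| = 6%N.
  move=> pq po qo op oq o3.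
  have -> : #|[set p; q] :|: cnb S o| = (#|[set p; q]| + #|cnb S o|)%N.
    apply/eqP; rewrite leq_card_setU disjoint_subset.
    apply/subsetP => y /set2P[]->; apply/negP.
      rewrite in_cnb eq_sym (negbTE op) e_sym (negbTE po) andbF; exact: notF.
    rewrite in_cnb eq_sym (negbTE oq) e_sym (negbTE qo) andbF; exact: notF.
  by rewrite cards2 pq card_cnb o3.
have outer t p q o : t \in S -> o \in S -> e t o -> nb S t = [set p; q; o] -> p != q ->
    ~~ e p o -> ~~ e q o -> o != p -> o != q -> #|nb S o| = 3%N ->
    (cnt S (mated S t o))%:R <= x ^+ 6 * weight S.
  move=> tS oS to Et pq po qo op oq o3; apply: mated_le => //.
  apply/andP; split=> //; apply: leq_trans (_ : #|[set p; q] :|: cnb S o| <= _)%N.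
    by rewrite six.
  apply/subset_leq_card/setSU/subsetP => y yp.
  by rewrite in_cnb -in_nb Et inE yp orbT.
(* For the sets missing the triangle, with [oa] mated to [u]: N[oa], which contains [a], is removed
   together with [b] and [c], at least 6 vertices. *)
pose none u : pred {set T} := fun F =>
  F :&: ([set b; c] :|: (cnb S oa :|: cnb S u)) == [set oa; u].
have none_le : (cnt S (fun F => [exists u in nb S oa :\ a, none u F]))%:R
    <= 2%:R * (x ^+ 6 * weight S).
  have c2 : #|nb S oa :\ a| = 2%N.
    by move: (cardsD1 a (nb S oa)); rewrite oa3 in_nb aS e_sym aoa => -[].
  rewrite -[X in X%:R * _]c2; apply: exists_le => u; rewrite in_setD1 in_nb => /and3P[ua uS oau].
  apply: (deleted_le IH (D := [set b; c] :|: (cnb S oa :|: cnb S u))).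
  - apply: cnt_trace => s y /set2P[] -> yS sy; apply/setUP; right; apply/setUP.
      by left; rewrite in_cnb yS sy orbT.
    by right; rewrite in_cnb yS sy orbT.
  - apply/subUsetP; split; first by apply/subsetP => y /set2P[]->.
    by apply/subUsetP; split; apply: cnb_sub.
  - apply/andP; split=> //; apply: leq_trans (_ : #|[set b; c] :|: cnb S oa| <= _)%N.
      by rewrite (six _ _ _ (ne _ _ bc)).
    by rewrite setUA subset_leq_card ?subsetUl.
have cov := @cnt_cover S [:: mated S a b; mated S a c; mated S b c;
  mated S a oa; mated S b ob; mated S c oc;
  isolated S a; isolated S b; isolated S c; fun F => [exists u in nb S oa :\ a, none u F]].
apply: le_lt_trans (cov _) _ => {cov} [F FS|].
  have inF t p q o : nb S t = [set p; q; o] -> t \in F ->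
     [|| isolated S t F, mated S t p F, mated S t q F | mated S t o F].
    move=> Et tF; case/orP: (in_maxdissP FS tF) => [->//|/exists_inP[u + mu]].
    by rewrite Et => /setUP[/set2P[]|/set1P] uE; rewrite -uE mu !orbT.
  have msym t u : mated S t u F = mated S u t F.
    by rewrite /mated (setUC (cnb S t)) (setUC [set t]).
  have [aF|aF] := boolP (a \in F).
    by case/or4P: (inF _ _ _ _ Ea aF) => /= ->; rewrite ?orbT.
  have [bF|bF] := boolP (b \in F).
    by case/or4P: (inF _ _ _ _ Eb bF) => /=; rewrite ?(msym b a) => ->; rewrite ?orbT.
  have [cF|cF] := boolP (c \in F).
    by case/or4P: (inF _ _ _ _ Ec cF) => /=; rewrite ?(msym c) => ->; rewrite ?orbT.
  have sFS := subsetP (maxdiss_sub FS).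
  (* With [b] and [c] absent, [oa] is the only neighbour of [a] left in [F], so [a] must be blocked
     by a mate of [oa]. *)
  have onlyoa p : p \in F -> e a p -> p = oa.
    move=> pF ap; have : p \in nb S a by rewrite in_nb sFS.
    by rewrite Ea => /setUP[/set2P[]|/set1P] E //; subst p; [rewrite pF in bF | rewrite pF in cF].
  have [p [q [pF qF ap H]]] := maxdiss_ext FS aS aF.
  have pE := onlyoa _ pF ap; subst p.
  have oaq : e oa q by case: H => // -[aq]; rewrite (onlyoa _ qF aq) eqxx.
  have qa : q != a by apply: contraNneq aF => <-.
  suff /= -> : [exists u in nb S oa :\ a, none u F] by rewrite !orbT.
  apply/exists_inP; exists q; first by rewrite in_setD1 qa in_nb sFS.
  rewrite /none setIUr.
  have -> : F :&: [set b; c] = set0.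
    apply/setP => y; rewrite in_setI in_set0; apply/negP => /andP[yF /set2P[]yE]; subst y.
      by rewrite yF in bF.
    by rewrite yF in cF.
  by rewrite set0U; apply/matedP.
have W0 := weight_gt0 S; have [_ [b5 b6 b7]] := x_pow_bounds (ltW W0).
rewrite !big_cons big_nil.
have := pair a b aS bS ab a3; have := pair a c aS cS ac a3; have := pair b c bS cS bc b3.
have := outer _ _ _ _ aS oaS aoa Ea (ne _ _ bc) n_boa n_coa oab oac oa3.
have := outer _ _ _ _ bS obS bob Eb (ne _ _ ca) n_cob n_aob obc oba ob3.
have := outer _ _ _ _ cS ocS coc Ec (ne _ _ ab) n_aoc n_boc oca ocb oc3.
have := iso a b ob aS bS ab a3 obS (ex_intro _ c (conj ac Eb)) n_aob oba.
have := iso b c oc bS cS bc b3 ocS (ex_intro _ a (conj ba Ec)) n_boc ocb.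
have := iso c a oa cS aS ca c3 oaS (ex_intro _ b (conj cb Ea)) n_coa oac.
rewrite -!(mulrA 2); lra.
Qed.

(** If two neighbours of [v] are adjacent, [cubic_triangle] applies. Otherwise N[u] and N[v]
    together have 6 vertices for each neighbour [u], and the sum is x + x^4 + 3 x^6. *)
Lemma cubic S v : smaller_bounded S -> v \in S -> #|nb S v| = 3%N ->
    (forall u, u \in S -> #|nb S u| = 3%N -> dominated S u = set0) ->
    (forall u w, u \in S -> #|nb S u| = 3%N -> w \in nb S u -> #|nb S w| = 3%N) ->
  (#|maxdiss S|)%:R < weight S.
Proof.
move=> IH vS d3 D0 H3; have W0 := weight_gt0 S.
have [[b1 _ b3 b4] [b5 b6 b7]] := x_pow_bounds (ltW W0).
have mem u w : w \in nb S u -> w \in S /\ e u w by rewrite in_nb => /andP.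
case: (boolP [exists a in nb S v, exists b in nb S v, e a b]).
  case/exists_inP => a aN /exists_inP[b bN ab].
  have [aS va] := mem _ _ aN; have [bS vb] := mem _ _ bN.
  have av : a != v by apply: contraTneq va => ->; rewrite e_irr.
  have bv : b != v by apply: contraTneq vb => ->; rewrite e_irr.
  have nab : a != b by apply: contraTneq ab => ->; rewrite e_irr.
  have a3 := H3 _ _ vS d3 aN; have b3' := H3 _ _ vS d3 bN.
  have [ov [ovN ova ovb Ev]] := third_element d3 aN bN nab.
  have [|||oa [oaN oab oav Ea]] := third_element (a := b) (b := v) a3.
  - by rewrite in_nb bS.
  - by rewrite in_nb vS e_sym.
  - by [].
  have [|||ob [obN obv oba Eb]] := third_element (a := v) (b := a) b3'.
  - by rewrite in_nb vS e_sym.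
  - by rewrite in_nb aS e_sym.
  - by rewrite eq_sym.
  apply: (@cubic_triangle S v a b ov oa ob) => //.
  - exact: H3 vS d3 ovN.
  - exact: H3 aS a3 oaN.
  - exact: H3 bS b3' obN.
move/exists_inPn => noE.
have := branch vS; rewrite -(ler_nat R) !natrD => /le_lt_trans; apply.
have av := avoids_le IH vS.
have iso : (cnt S (isolated S v))%:R <= x ^+ 4 * weight S by apply: isolated_le; rewrite ?d3.
have mat : (cnt S (fun F => [exists u in nb S v, mated S v u F]))%:R <= 3%:R * (x ^+ 6 * weight S).
  rewrite -d3; apply: exists_le => u uN; have [uS vu] := mem _ _ uN.
  apply: mated_le => //; have u3 := H3 _ _ vS d3 uN.
  have vN : v \in nb S u by rewrite in_nb vS e_sym.
  apply/andP; split=> //; apply: leq_trans (_ : #|cnb S v :|: (nb S u :\ v)| <= _)%N.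
    have -> : #|cnb S v :|: (nb S u :\ v)| = (#|cnb S v| + #|nb S u :\ v|)%N.
      apply/eqP; rewrite leq_card_setU disjoint_sym disjoint_subset.
      apply/subsetP => y /setD1P[yv yu]; apply/negP; rewrite in_cnb (negbTE yv) -in_nb /= => yN.
      have /exists_inPn/(_ _ yN)/negP := noE _ uN; apply.
      by move: yu; rewrite in_nb => /andP[].
    by move: (cardsD1 v (nb S u)); rewrite vN u3 card_cnb d3 add1n => -[<-].
  by apply/subset_leq_card/setUS/subsetP => y /setD1P[_ yu]; rewrite in_cnb -in_nb yu orbT.
lra.
Qed.

(** * The 2-regular case *)

Lemma second_element (A : {set T}) a : #|A| = 2%N -> a \in A ->
  exists b, b != a /\ A = [set a; b].
Proof.
move=> A2 aA; have := cardsD1 a A; rewrite A2 aA add1n => -[/esym/eqP/cards1P[b bE]].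
have : b \in A :\ a by rewrite bE set11.
by rewrite in_setD1 => /andP[ba _]; exists b; rewrite -bE setD1K.
Qed.

(** Walking from [v] in both directions closes a triangle or a 4-cycle, which is a small component,
    or meets five distinct vertices w1, u1, v, u2, w2. Then [v] is isolated, or one of the four path
    edges is mated, or [v] is absent with u1 and u2 isolated: x^3 + 4 x^4 + x^5. *)
Lemma two_regular S v : smaller_bounded S -> v \in S ->
  (forall u, u \in S -> #|nb S u| = 2%N) -> (#|maxdiss S|)%:R < weight S.
Proof.
move=> IH vS d2; have W0 := weight_gt0 S.
have [[b1 _ b3 b4] [b5 _ _]] := x_pow_bounds (ltW W0).
have mem t p q : nb S t = [set p; q] -> [/\ p \in S, q \in S, e t p & e t q].
  move=> E; have /andP[] : (p \in S) && e t p by rewrite -in_nb E set21.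
  by have /andP[] : (q \in S) && e t q by rewrite -in_nb E set22.
have only t p q y : nb S t = [set p; q] -> y \in S -> e t y -> y = p \/ y = q.
  by move=> E yS ty; apply/set2P; rewrite -E in_nb yS.
have ne u w : e u w -> u != w by apply: contraTneq => ->; rewrite e_irr.
have [u1 [u2 [u12 Ev]]] : exists u1 u2, u2 != u1 /\ nb S v = [set u1; u2].
  have /card_gt0P[u1 u1N] : (0 < #|nb S v|)%N by rewrite d2.
  by have [u2 H] := second_element (d2 _ vS) u1N; exists u1, u2.
have [u1S u2S vu1 vu2] := mem _ _ _ Ev.
have nbr u : u \in S -> e v u -> exists w, w != v /\ nb S u = [set v; w].
  by move=> uS vu; apply: second_element; rewrite ?d2 // in_nb vS e_sym.
have [w1 [w1v E1]] := nbr _ u1S vu1; have [w2 [w2v E2]] := nbr _ u2S vu2.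
have [_ w1S u1v u1w1] := mem _ _ _ E1; have [_ w2S u2v u2w2] := mem _ _ _ E2.
have [adj|nadj] := boolP (e u1 u2).
  have w1E : w1 = u2.
    by case: (only _ _ _ _ E1 u2S adj) => // u2E; rewrite u2E e_irr in vu2.
  have w2E : w2 = u1.
    rewrite e_sym in adj; case: (only _ _ _ _ E2 u1S adj) => // u1E.
    by rewrite u1E e_irr in vu1.
  subst w1 w2.
  apply: (@small_component_lt S (cnb S v)); rewrite ?card_cnb ?d2 //.
  apply: dominated_full_component => //; apply/eqP; rewrite eqEsubset dominated_sub.
  apply/subsetP => u uN; rewrite inE uN /=; apply/subsetP => y.
  rewrite !in_cnb -!in_nb Ev; move: uN; rewrite Ev => /set2P[]->; rewrite ?E1 ?E2 !in_set2.
    by case/or3P => ->; rewrite ?orbT.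
  by case/or3P => ->; rewrite ?orbT.
have u1w2 : u1 != w2 by apply: contraNneq nadj => ->; rewrite e_sym.
have u2w1 : u2 != w1 by apply: contraNneq nadj => ->.
have [w12|w12] := eqVneq w1 w2.
  subst w2.
  have Ew : nb S w1 = [set u1; u2].
    apply/esym/eqP; rewrite eqEcard cards2 d2 // eq_sym u12 andbT.
    by apply/subsetP => y /set2P[]->; rewrite in_nb ?u1S ?u2S e_sym.
  apply: (@small_component_lt S [set v; w1; u1; u2]) => //; last first.
    have c3 : #|[set v; w1; u1]| = 3%N.
      by rewrite cards3 ?(ne _ _ vu1) // eq_sym ?(ne _ _ u1w1).
    rewrite setUC cardsU1 c3 !inE.
    by rewrite (negbTE (ne _ _ u2v)) (negbTE (ne _ _ u2w2)) (negbTE u12).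
  split; first by apply/subsetP => y; rewrite !inE => /orP[/orP[/orP[]|]|]/eqP->.
  move=> a y; rewrite !inE => /orP[/orP[/orP[]|]|]/eqP-> yS ay.
  - by case: (only _ _ _ _ Ev yS ay) => ->; rewrite eqxx ?orbT.
  - by case: (only _ _ _ _ Ew yS ay) => ->; rewrite eqxx ?orbT.
  - by case: (only _ _ _ _ E1 yS ay) => ->; rewrite eqxx ?orbT.
  - by case: (only _ _ _ _ E2 yS ay) => ->; rewrite eqxx ?orbT.
have nw1v : ~~ e w1 v.
  apply/negP; rewrite e_sym => vw1; case: (only _ _ _ _ Ev w1S vw1) => E.
    by rewrite E e_irr in u1w1.
  by rewrite E eqxx in u2w1.
have nw2v : ~~ e w2 v.
  apply/negP; rewrite e_sym => vw2; case: (only _ _ _ _ Ev w2S vw2) => E.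
    by rewrite E eqxx in u1w2.
  by rewrite E e_irr in u2w2.
(* For consecutive vertices p, q, r, s, mating q with r removes all four. *)
have path4 p q r s : p \in S -> q \in S -> nb S q = [set p; r] -> e r s -> s != p -> s != q ->
    r \in S -> s \in S -> ~~ e q s ->
    (cnt S (mated S q r))%:R <= x ^+ 4 * weight S.
  move=> pS qS Eq rs sp sq rS sS nqs; apply: mated_le => //.
  apply/andP; split=> //; have <- : #|s |: cnb S q| = 4%N.
    by rewrite cardsU1 card_cnb d2 // in_cnb negb_or sq negb_and nqs orbT.
  apply/subset_leq_card/subsetP => y; rewrite in_setU1 in_setU => /predU1P[->|->] //.
  by rewrite (in_cnb S r) sS rs !orbT.
have iso : (cnt S (isolated S v))%:R <= x ^+ 3 * weight S.
  by apply: isolated_le; rewrite ?d2.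
have m1 : (cnt S (mated S v u1))%:R <= x ^+ 4 * weight S.
  apply: (path4 u2 v u1 w1) => //; rewrite ?(eq_sym w1) //; first by rewrite Ev setUC.
  by rewrite e_sym.
have m2 : (cnt S (mated S v u2))%:R <= x ^+ 4 * weight S.
  by apply: (path4 u1 v u2 w2) => //; rewrite 1?(eq_sym w2) // e_sym.
have outer u w : u \in S -> nb S u = [set v; w] -> w \in S -> e u w -> ~~ e w v -> w != v ->
    (cnt S (mated S u w))%:R <= x ^+ 4 * weight S.
  move=> uS Eu wS uw nwv wv.
  have [z [zu Ew]] : exists z, z != u /\ nb S w = [set u; z].
    by apply: second_element; rewrite ?d2 // in_nb uS e_sym.
  have [_ zS wu wz] := mem _ _ _ Ew.
  have zv : z != v by apply: contraNneq nwv => <-.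
  apply: (path4 v u w z) => //; apply/negP => uz.
  by case: (only _ _ _ _ Eu zS uz) => E; [rewrite E eqxx in zv | rewrite E e_irr in wz].
have o1 := outer _ _ u1S E1 w1S u1w1 nw1v w1v.
have o2 := outer _ _ u2S E2 w2S u2w2 nw2v w2v.
pose both : pred {set T} := fun F => F :&: (cnb S u1 :|: cnb S u2) == [set u1] :|: [set u2].
have both_le : (cnt S both)%:R <= x ^+ 5 * weight S.
  apply: (deleted_le IH (D := cnb S u1 :|: cnb S u2)).
  - apply: cnt_trace => s y /set2P[] -> yS sy; apply/setUP; [left | right];
      by rewrite in_cnb yS sy orbT.
  - by apply/subUsetP; split; apply: cnb_sub.
  apply/andP; split=> //; have <- : #|u2 |: (w2 |: cnb S u1)| = 5%N.
    rewrite (cardsU1 u2) (cardsU1 w2 (cnb S u1)) card_cnb d2 //.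
    rewrite (in_setU1 u2) !in_cnb -!in_nb E1 !in_set2.
    rewrite (negbTE (ne _ _ u2w2)) (negbTE u12) (negbTE (ne _ _ u2v)) (negbTE u2w1).
    by rewrite eq_sym (negbTE u1w2) (negbTE w2v) eq_sym (negbTE w12).
  apply/subset_leq_card/subsetP => y.
  rewrite in_setU1 (in_setU1 y w2) in_setU (in_cnb S u2) => /or3P[/eqP->|/eqP->|->//].
    by rewrite eqxx orbT.
  by rewrite w2S u2w2 !orbT.
have cov := @cnt_cover S [:: isolated S v; mated S v u1; mated S v u2;
  mated S u1 w1; mated S u2 w2; both].
apply: le_lt_trans (cov _) _ => {cov} [F FS|]; last by rewrite !big_cons big_nil; lra.
have sFS := subsetP (maxdiss_sub FS).
have [vF|vF] := boolP (v \in F).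
  case/orP: (in_maxdissP FS vF) => [/= ->//|/exists_inP[u + mu]].
  by rewrite Ev => /set2P uE; case: uE mu => -> /= ->; rewrite ?orbT.
have inF u w : u \in S -> nb S u = [set v; w] -> u \in F -> isolated S u F || mated S u w F.
  move=> uS Eu uF; case/orP: (in_maxdissP FS uF) => [->//|/exists_inP[z + mz]].
  rewrite Eu => /set2P[]zE; subst z; last by rewrite mz orbT.
  have [_ _ uv _] := mem _ _ _ Eu.
  by have [_ vF'] := matedP FS uv mz; rewrite vF' in vF.
(* If neither u1 w1 nor u2 w2 is mated, any of u1, u2 in [F] is isolated, so only the presence of
   both can block [v]. *)
have [p [q [pF qF vp H]]] := maxdiss_ext FS vS vF.
have nbF z : z \in F -> e v z -> z = u1 \/ z = u2.
  by move=> zF; apply: only Ev _; apply: sFS.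
have iso_nb u z : isolated S u F -> z \in F -> ~~ e u z.
  by move=> /(isolatedP _ FS)[_]; apply.
have [u1F|u1F] := boolP (u1 \in F).
  case/orP: (inF _ _ u1S E1 u1F) => [i1|/= ->]; last by rewrite ?orbT.
  have [u2F|u2F] := boolP (u2 \in F).
    case/orP: (inF _ _ u2S E2 u2F) => [i2|/= ->]; last by rewrite ?orbT.
    suff /= -> : both F by rewrite ?orbT.
    by rewrite /both setIUr (eqP i1) (eqP i2).
  have pE : p = u1 by case: (nbF _ pF vp) => // E; rewrite -E pF in u2F.
  subst p; case: H => [|[vq qu1]]; first by rewrite (negbTE (iso_nb _ _ i1 qF)).
  by case: (nbF _ qF vq) => E; [rewrite E eqxx in qu1 | rewrite -E qF in u2F].
have pE : p = u2 by case: (nbF _ pF vp) => // E; rewrite -E pF in u1F.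
subst p; case/orP: (inF _ _ u2S E2 pF) => [i2|/= ->]; last by rewrite ?orbT.
case: H => [|[vq qu2]]; first by rewrite (negbTE (iso_nb _ _ i2 qF)).
by case: (nbF _ qF vq) => E; [rewrite -E qF in u1F | rewrite E eqxx in qu2].
Qed.

(** * The induction and the equality case *)

(** Degrees are settled in the order at most 1, at least 5, equal to 4, then 2 and 3; only degree 4
    leaves the exception, with N[v] as the component. *)
Lemma weight_dichotomy S : smaller_bounded S -> S != set0 ->
  (#|maxdiss S|)%:R < weight S \/ exists C, component S C /\ #|C| = 5%N.
Proof.
move=> IH S0.
case: (boolP [exists v in S, #|nb S v| <= 1]%N) => [/exists_inP[v vS d]|/exists_inPn min2].
  by left; apply: low_degree_lt IH vS d.
case: (boolP [exists v in S, 5 <= #|nb S v|]%N) => [/exists_inP[v vS d]|/exists_inPn max4].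
  by left; apply: high_degree_lt IH vS d.
case: (boolP [exists v in S, #|nb S v| == 4%N]) => [/exists_inP[v vS /eqP d]|/exists_inPn max3].
  case: (degree4 IH vS d) => [|cC]; first by left.
  by right; exists (cnb S v); rewrite card_cnb d.
left.
have d23 v : v \in S -> #|nb S v| = 2%N \/ #|nb S v| = 3%N.
  move=> vS; move: (min2 _ vS) (max4 _ vS) (max3 _ vS).
  by case: #|nb S v| => [|[|[|[|[|[|n]]]]]] //; auto.
have le3 v : v \in S -> (#|nb S v| <= 3)%N by move/d23 => [] ->.
case: (boolP [exists v in S, #|nb S v| == 3%N]) => [|/exists_inPn max2]; last first.
  have [v vS] := set0Pn _ S0; apply: two_regular IH vS _ => u uS.
  by case: (d23 _ uS) (max2 _ uS) => // ->.
case/exists_inP => v vS /eqP d3.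
case: (boolP [exists u in S, (#|nb S u| == 3%N) && (dominated S u != set0)]).
  by case/exists_inP => u uS /andP[/eqP u3 du]; apply: degree3_dominated IH uS u3 le3 du.
move/exists_inPn => nodom.
have D0 u : u \in S -> #|nb S u| = 3%N -> dominated S u = set0.
  by move=> uS u3; have := nodom _ uS; rewrite u3 /= negbK => /eqP.
case: (boolP [exists u in S, (#|nb S u| == 3%N) && [exists w in nb S u, #|nb S w| == 2%N]]).
  case/exists_inP => u uS /andP[/eqP u3 /exists_inP[w wN /eqP w2]].
  by apply: degree3_degree2 IH uS u3 (D0 _ uS u3) wN w2.
move/exists_inPn => no2; apply: cubic IH vS d3 D0 _ => u w uS u3 wN.
have := no2 _ uS; rewrite u3 /= => /exists_inPn/(_ _ wN).
have wS : w \in S by move: wN; rewrite in_nb => /andP[].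
by case: (d23 _ wS) => ->.
Qed.

Definition good_partition (P : {set {set T}}) S :=
  [/\ partition P S,
      forall B1 B2 u v, B1 \in P -> B2 \in P -> B1 != B2 -> u \in B1 -> v \in B2 -> ~~ e u v &
      forall B, B \in P -> exists M, [/\ matching_K5 M, #|M| <= 2 & induced_iso_K5_minus e B M]]%N.

(** Strong induction on |S|. A component [C] of order 5 contributes a factor at most 10, exactly the
    ratio of the weights of [S] and [S :\: C]. Equality for [S] thus forces equality in both
    factors, and [C] joins the partition of the rest. *)
Lemma maxdiss_le_weight S :
  (#|maxdiss S|)%:R <= weight S /\
  ((#|maxdiss S|)%:R = weight S -> exists P, good_partition P S).
Proof.
have [n] := ubnP #|S|; elim: n S => // n IHn S; rewrite ltnS => Sn.
have IH : smaller_bounded S.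
  by move=> S' S'S; have [] := IHn S' (leq_trans (proper_card S'S) Sn).
have [->|S0] := eqVneq S set0.
  rewrite /weight cards0 expr0; split.
    by have := @maxdiss_small set0 0 (cards0 _) isT; rewrite -(ler_nat R).
  move=> _; exists set0; split=> [|B1 B2 u v|B]; rewrite ?inE //.
  by apply/and3P; split; rewrite ?inE // /cover ?big_set0 //; apply/trivIsetP => A B; rewrite inE.
case: (weight_dichotomy IH S0) => [lt|[C [cC C5]]].
  by split; [apply: ltW | move=> E; rewrite E ltxx in lt].
have [CS clC] := cC.
have le10 := maxdiss_small C5 isT; rewrite /= in le10.
have prD : S :\: C \proper S.
  rewrite properE subsetDl /=; apply/subsetPn.
  have /card_gt0P[v vC] : (0 < #|C|)%N by rewrite C5.
  by exists v; [apply: (subsetP CS) | rewrite inE vC].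
have [leD eqD] := IHn (S :\: C) (leq_trans (proper_card prD) Sn).
have WE : weight S = 10%:R * weight (S :\: C).
  by rewrite weightD // C5 x5 mulrA divff ?mul1r // pnatr_eq0.
have WD0 := weight_gt0 (S :\: C).
rewrite (maxdiss_component cC) natrM WE.
have le10R : (#|maxdiss C|)%:R <= 10%:R :> R by rewrite ler_nat.
split; first by apply: ler_pM.
move=> E.
have mC : #|maxdiss C| = 10%N.
  apply/eqP; rewrite -(eqr_nat R) eq_le le10R /= -(ler_pM2r WD0) -E.
  by apply: ler_wpM2l.
have [|P [pP sepP isoP]] := eqD.
  by apply/eqP; rewrite -(inj_eq (@mulfI R 10%:R _)) ?pnatr_eq0 // -E mC.
exists (C |: P); split.
- rewrite -[S](setID S C) (setIidPr CS); apply: partitionU1 => //.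
    by rewrite -card_gt0 C5.
  by rewrite disjoint_subset; apply/subsetP => y yC; rewrite !inE yC.
- have sub B y : B \in P -> y \in B -> y \in S :\: C.
    by move=> BP; apply: (subsetP (partitionS pP BP)).
  have noE y z : y \in C -> z \in S :\: C -> ~~ e y z.
    by move=> yC /setDP[zS]; apply: contra; apply: clC.
  move=> B1 B2 y z /setU1P[->|B1P] /setU1P[->|B2P] B12 yB zB.
  + by rewrite eqxx in B12.
  + by apply: noE yB (sub _ _ B2P zB).
  + by rewrite e_sym; apply: noE zB (sub _ _ B1P yB).
  + exact: sepP B1P B2P B12 yB zB.
- move=> B /setU1P[->|/isoP //]; exact: K5_minus_of_maxdiss.
Qed.

(** Each block is a component contributing a factor 10; blocks are removed one at a time. *)
Lemma good_partition_maxdiss P S : good_partition P S -> #|maxdiss S| = (10 ^ #|P|)%N.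
Proof.
have [n] := ubnP #|P|; elim: n P S => // n IHn P S; rewrite ltnS => Pn [pP sepP isoP].
have [P0|[B BP]] := set_0Vmem P.
  have S0 : S = set0 by rewrite -(cover_partition pP) P0 /cover big_set0.
  rewrite S0 P0 cards0 expn0; apply/eqP; rewrite eqn_leq.
  rewrite (@maxdiss_small set0 0 (cards0 _) isT) /=.
  by have [F FS] := maxdiss_exists set0; apply/card_gt0P; exists F.
have [M [MK _ BM]] := isoP _ BP.
have cB : component S B.
  split=> [|u v uB vS uv]; first exact: partitionS pP BP.
  have vP : v \in cover P by rewrite (cover_partition pP).
  case/bigcupP: vP => B' B'P vB'.
  have [<- //|BB'] := eqVneq B' B.
  by have := sepP B B' u v BP B'P; rewrite eq_sym BB' uB vB' uv => /(_ isT isT isT).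
rewrite (maxdiss_component cB) (maxdiss_K5_minus MK BM).
rewrite (IHn (P :\ B)); first by rewrite [in RHS](cardsD1 B) BP add1n expnS.
  by apply: leq_trans Pn; rewrite [in X in (_ < X)%N](cardsD1 B) BP.
split=> [|B1 B2 u v /setD1P[_ B1P] /setD1P[_ B2P]|B' /setD1P[_ /isoP //]].
  exact: partitionD1.
exact: sepP.
Qed.

Lemma good_partition_card P S : good_partition P S -> #|S| = (#|P| * 5)%N.
Proof.
case=> pP _ isoP; apply: card_uniform_partition pP => B /isoP[M [_ _ [f [fI <- _]]]].
by rewrite card_imset // cardsT card_ord.
Qed.

End MaximumDissociationSets.

(** * The fifth root of 1/10 and the return to natural numbers *)

(** The polynomial X^5 - 1/10 changes sign on [0, 1], and the real algebraic numbers form a real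
    closed field. *)
Lemma tenth_root_exists : exists2 x : realalg, (0 < x)%R & (x ^+ 5 = 10%:R^-1)%R.
Proof.
pose p : {poly realalg} := ('X^5 - (10%:R^-1)%:P)%R.
have pE (y : realalg) : (p.[y] = y ^+ 5 - 10%:R^-1)%R.
  by rewrite /p hornerD hornerN hornerC hornerXn.
have [|x /andP[x0 _]] := @poly_ivt realalg p 0%R 1%R ler01.
  by rewrite !pE expr0n expr1n /= sub0r oppr_le0 invr_ge0 ler0n subr_ge0 invf_le1 ?ltr0n // ler1n.
rewrite /root pE subr_eq0 => /eqP x5; exists x => //.
rewrite lt_neqAle x0 andbT; apply/eqP => E; move: x5.
by rewrite -E expr0n /= => /esym/eqP; rewrite invr_eq0 pnatr_eq0.
Qed.

Theorem theorem1p3 (T : finType) (e : rel T)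
    (e_sym : symmetric e) (e_irr : irreflexive e) :
  (num_max_diss e) ^ 5 <= 10 ^ #|T|
  /\
  ((num_max_diss e) ^ 5 = 10 ^ #|T| <->
   (5 %| #|T| /\
    exists P : {set {set T}},
      [/\ partition P [set: T],
          #|P| = #|T| %/ 5,
          (forall B1 B2 x y, B1 \in P -> B2 \in P -> B1 != B2 ->
              x \in B1 -> y \in B2 -> ~~ e x y) &
          (forall B, B \in P ->
              exists M : {set {set 'I_5}},
                [/\ matching_K5 M, #|M| <= 2 & induced_iso_K5_minus e B M])])).
Proof.
have [x x0 x5] := tenth_root_exists.
have [le eqW] := maxdiss_le_weight e_sym e_irr x0 x5 [set: T].
have W0 := weight_gt0 x0 [set: T].
(* Fifth powers carry both the bound and its equality case over to natural numbers. *)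
have W5 : (weight x [set: T] ^+ 5 = (10 ^ #|T|)%N%:R)%R.
  by rewrite /weight cardsT -exprM mulnC exprM exprVn x5 invrK natrX.
rewrite num_max_dissE; split.
  by rewrite -(ler_nat realalg) natrX -W5 lerXn2r // nnegrE ?ler0n // ltW.
split=> [E|[d5 [P [pP Pc sepP isoP]]]].
  have /eqW[P gP] : ((#|maxdiss e [set: T]|)%:R = weight x [set: T])%R.
    apply/eqP; rewrite -(@eqrXn2 _ 5) // ?ler0n ?ltW //.
    by rewrite W5 -natrX E.
  have cT := good_partition_card gP; rewrite cardsT in cT; rewrite cT.
  split; first exact: dvdn_mull.
  by case: gP => pP sepP isoP; exists P; split; rewrite ?mulnK.
have gP : good_partition e P [set: T] by split.
by rewrite (good_partition_maxdiss e_sym e_irr gP) Pc -expnM divnK.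
Qed.
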